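(* Let $d\ge2$ be an integer and $a\in(l_0(\mathbb{Z}))^{r\times r}$ a finitely supported matrix-valued filter. Let $\phi$ be an $r\times1$ vector of compactly supported distributions satisfying $\widehat{\phi}(d\xi)=\widehat{a}(\xi)\widehat{\phi}(\xi)$ with $\widehat{\phi}(0)\ne0$. Suppose that $a$ has $m$ sum rules with respect to $d$ with a matching filter $\upsilon\in(l_0(\mathbb{Z}))^{1\times r}$ such that $\widehat{\upsilon}(0)\widehat{\phi}(0)=1$. Let $\widehat{\mathring{\upsilon}}$ be a $1\times r$ row vector and $\widehat{u_\phi}$ an $r\times1$ column vector such that all entries of $\widehat{\mathring{\upsilon}}$ and $\widehat{u_\phi}$ are functions which are smooth near the origin and $$\widehat{\mathring{\upsilon}}(\xi)\widehat{u_\phi}(\xi)=1+\mathscr{O}(|\xi|^m),\qquad\xi\to0.$$ If the multiplicity $r\ge2$, then for any positive integer $n$ there exists a strongly invertible $r\times r$ matrix $\widehat{U}$ of $2\pi$-periodic trigonometric polynomials such that $$\widehat{\upsilon}(\xi)\widehat{U}(\xi)^{-1}=\widehat{\mathring{\upsilon}}(\xi)+\mathscr{O}(|\xi|^m)\quad\text{and}\quad\widehat{U}(\xi)\widehat{\phi}(\xi)=\widehat{u_\phi}(\xi)+\mathscr{O}(|\xi|^n),\qquad\xi\to0.$$ Define $\widehat{\mathring{\phi}}(\xi):=\widehat{U}(\xi)\widehat{\phi}(\xi)$ and $\widehat{\mathring{a}}(\xi):=\widehat{U}(d\xi)\widehat{a}(\xi)\widehat{U}(\xi)^{-1}$. Then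 the following hold: (i) $\mathring{\phi}$ is a vector of compactly supported distributions satisfying $\widehat{\mathring{\phi}}(d\xi)=\widehat{\mathring{a}}(\xi)\widehat{\mathring{\phi}}(\xi)$ for all $\xi\in\mathbb{R}$ and $\widehat{\mathring{\phi}}(\xi)=\widehat{u_\phi}(\xi)+\mathscr{O}(|\xi|^n)$ as $\xi\to0$. (ii) The finitely supported matrix filter $\mathring{a}$ has $m$ sum rules with respect to $d$ with the matching filter $\mathring{\upsilon}$ such that $\widehat{\mathring{\upsilon}}(0)\widehat{\mathring{\phi}}(0)=1$; i.e., as $\xi\to0$, $\widehat{\mathring{\upsilon}}(d\xi)\widehat{\mathring{a}}(\xi)=\widehat{\mathring{\upsilon}}(\xi)+\mathscr{O}(|\xi|^m)$ and $\widehat{\mathring{\upsilon}}(d\xi)\widehat{\mathring{a}}(\xi+\frac{2\pi\gamma}{d})=\mathscr{O}(|\xi|^m)$ for $\gamma=1,\ldots,d-1$.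
   Context: $l_0(\mathbb{Z})$ is the set of finitely supported complex sequences on $\mathbb{Z}$; for $u\in(l_0(\mathbb{Z}))^{s\times r}$, $\widehat{u}(\xi):=\sum_{k}u(k)e^{-ik\xi}$. The Fourier transform is $\widehat{f}(\xi)=\int f(x)e^{-ix\xi}dx$, extended to tempered distributions and applied entrywise to vectors. For $m\in\mathbb{N}$ (positive integers), $f(\xi)=g(\xi)+\mathscr{O}(|\xi|^m)$ as $\xi\to0$ means $f^{(j)}(0)=g^{(j)}(0)$ for $j=0,\ldots,m-1$ (entrywise). A function is smooth near the origin if all its derivatives at the origin exist. An $r\times r$ matrix of $2\pi$-periodic trigonometric polynomials is strongly invertible if its inverse is also a matrix of $2\pi$-periodic trigonometric polynomials. For $m\in\mathbb{N}$, $a\in(l_0(\mathbb{Z}))^{r\times r}$ has $m$ sum rules with respect to $d$ with matching filter $\upsilon$ if $\widehat{\upsilon}(0)\ne0$ and, as $\xi\to0$, $\widehat{\upsilon}(d\xi)\widehat{a}(\xi)=\widehat{\upsilon}(\xi)+\mathscr{O}(|\xi|^m)$ and $\widehat{\upsilon}(d\xi)\widehat{a}(\xi+\frac{2\pi\gamma}{d})=\mathscr{O}(|\xi|^m)$ for $\gamma=1,\ldots,d-1$. *)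

(* Defs.v *)
From HB Require Import structures.
From mathcomp Require Import all_boot all_order all_algebra.
From mathcomp Require Import finmap.
From mathcomp Require Import complex.
From mathcomp Require Import all_classical all_reals all_analysis.

Set Implicit Arguments.
Unset Strict Implicit.
Unset Printing Implicit Defensive.

Import Order.TTheory GRing.Theory Num.Theory.
Import numFieldNormedType.Exports.

Local Open Scope classical_set_scope.
Local Open Scope complex_scope.
Local Open Scope ring_scope.

(* The derivatives of f : R -> R[i] are taken componentwise: R[i] carries no
   canonical structure of normed space over R. *)
Definition cderive (R : realType) (n : nat) (f : R -> R[i]) (x : R) : R[i] :=
  derive1n n (fun t => complex.Re (f t)) x +i*
  derive1n n (fun t => complex.Im (f t)) x.

(* As [derive1n] is total, its value is meaningful only at points where the
   derivatives exist, which is what [cderivable] records for the (n+1)-st one. *)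
Definition cderivable (R : realType) (n : nat) (f : R -> R[i]) (x : R) : Prop :=
  derivable (derive1n n (fun t => complex.Re (f t))) x 1 /\
  derivable (derive1n n (fun t => complex.Im (f t))) x 1.

Definition smooth (R : realType) (f : R -> R[i]) : Prop :=
  forall (n : nat) (x : R), cderivable n f x.

(* All derivatives at 0 exist; the existence of the (n+1)-st derivative at 0
   presupposes that of the n-th one on a neighbourhood of 0, depending on n. *)
Definition smooth_near0 (R : realType) (f : R -> R[i]) : Prop :=
  forall n : nat, \forall x \near (0 : R), cderivable n f x.

Definition mx_smooth_near0 (R : realType) (p q : nat)
    (f : R -> 'M[R[i]]_(p, q)) : Prop :=
  forall i j, smooth_near0 (fun xi => f xi i j).

(* f(xi) = g(xi) + O(|xi|^m) as xi -> 0, entrywise. *)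
Definition eqO (R : realType) (m p q : nat)
    (f g : R -> 'M[R[i]]_(p, q)) : Prop :=
  forall n : nat, (n < m)%N -> forall i j,
    cderive n (fun xi => f xi i j) 0 = cderive n (fun xi => g xi i j) 0.

Definition expi (R : realType) (t : R) : R[i] := cos t +i* sin t.

(* Finitely supported sequences on Z of p x q complex matrices. *)
Notation l0 R p q := {fsfun int -> 'M[R[i]]_(p, q) with 0}.

Definition symbol (R : realType) (p q : nat) (u : l0 R p q) (xi : R) :
    'M[R[i]]_(p, q) :=
  \sum_(k <- finsupp u) expi (- (k%:~R * xi)) *: u k.

(* Matrices of 2pi-periodic trigonometric polynomials. *)
Definition trig_poly_mx (R : realType) (p q : nat)
    (A : R -> 'M[R[i]]_(p, q)) : Prop :=
  exists u : l0 R p q, forall xi, A xi = symbol u xi.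

Definition strongly_invertible (R : realType) (r : nat)
    (A : R -> 'M[R[i]]_r) : Prop :=
  [/\ trig_poly_mx A, forall xi, A xi \in unitmx
    & trig_poly_mx (fun xi => invmx (A xi))].

(* The matching filter enters only through its symbol, which need not be a
   trigonometric polynomial: v is the function written \hat\upsilon. *)
Definition sum_rules (R : realType) (r d m : nat) (a : l0 R r r)
    (v : R -> 'rV[R[i]]_r) : Prop :=
  [/\ v 0 != 0,
      eqO m (fun xi => v (d%:R * xi) *m symbol a xi) v
    & forall gamma : nat, (1 <= gamma <= d.-1)%N ->
      eqO m (fun xi => v (d%:R * xi) *m
                       symbol a (xi + 2 * pi * gamma%:R / d%:R))
            (fun=> 0)].

(* Compactly supported distributions on R: the dual E'(R) of C^oo(R; C) with
   its Frechet topology, i.e. the linear functionals T with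
     |T f| <= C * max_(n <= N) sup_([-M, M]) |f^(n)|
   for some C, N and M.  [cdistr_val] is total, but its values at functions
   that are not smooth are irrelevant. *)
Record cdistr (R : realType) := CDistr {
  cdistr_val :> (R -> R[i]) -> R[i] ;
  cdistr_linear : forall (c : R[i]) (f g : R -> R[i]), smooth f -> smooth g ->
    cdistr_val (fun x => c * f x + g x) = c * cdistr_val f + cdistr_val g ;
  cdistr_continuous : exists (C : R) (N : nat) (M : R),
    forall (f : R -> R[i]) (B : R), smooth f ->
      (forall n x, (n <= N)%N -> `|x| <= M ->
        ComplexField.Normc.normc (cderive n f x) <= B) ->
      ComplexField.Normc.normc (cdistr_val f) <= C * B }.

(* The Fourier transform of T in E'(R) is the function xi |-> <T, e^(-i x xi)>;
   for T given by an integrable function of compact support this is the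
   integral of T(x) e^(-i x xi). *)
Definition fourier (R : realType) (T : cdistr R) (xi : R) : R[i] :=
  T (fun x => expi (- (x * xi))).

Definition fourier_col (R : realType) (r : nat) (phi : 'I_r -> cdistr R)
    (xi : R) : 'cV[R[i]]_r :=
  \col_i fourier (phi i) xi.

(* Main.v *)
Require Import Defs.
From HB Require Import structures.
From mathcomp Require Import all_boot all_order all_algebra.
From mathcomp Require Import finmap.
From mathcomp Require Import complex.
From mathcomp Require Import all_classical all_reals all_analysis.
From mathcomp Require Import qpoly ring lra.

Set Implicit Arguments.
Unset Strict Implicit.
Unset Printing Implicit Defensive.

Import Order.TTheory GRing.Theory Num.Theory.
Import numFieldNormedType.Exports.

Local Open Scope classical_set_scope.
Local Open Scope complex_scope.
Local Open Scope ring_scope.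

(** Only Taylor coefficients at the origin enter the requirements on U. Fix
    N >= m, n and let A be the ring C[X]/(X^(N+1)) of Taylor jets of order N.
    Products of functions that are smooth near 0 become products in A
    ([jetM]), so the problem concerns a row v and a column phi over A, which
    an invertible matrix U moves to v U^-1 and U phi.

    The refinement equation and the first sum rule give
    (v phi)(d xi) = (v phi)(xi) + O(|xi|^m). Comparing coefficients,
    (d^k - 1) (v phi)^(k)(0) = 0 for k < m, hence v phi = 1 + O(|xi|^m)
    ([pairing_eq1]). Thus both (v, phi) and (v0, uphi) have pairing
    1 + x^m z in A. This is a unit; dividing the rows by it makes the
    pairings exactly 1 and changes the rows only modulo x^m
    ([unit_pairing]), which is the precision asked of the rows. The columns
    may be asked to agree to any order n, also beyond m, because they are not
    touched.

    Over any commutative ring, shears 1 + x y with x and y of disjoint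
    supports act transitively on pairs (v, phi) with v phi = 1 such that phi
    has an invertible entry, as soon as r >= 2 ([elementary_transitive]):
    one shear makes a chosen entry of phi equal to 1, another clears the
    remaining ones, a third clears the row and fixes the column. A shear lifts
    from A to an invertible matrix of trigonometric polynomials: every jet is
    the jet of a trigonometric polynomial ([trig_has_jet]), and if zero
    entries are lifted to zero then the lifts X and Y have disjoint supports,
    so that Y X = 0 and 1 - X Y is inverse to 1 + X Y ([elementary_lift]).
    This yields U ([exists_strongly_invertible]).

    The Fourier transform of a compactly supported distribution T must be
    known to be smooth for its jets to make sense. Its derivative is the
    transform of - i x T: the remainder of the difference quotient is T applied
    to a function all of whose derivatives are O(h^2) on compact sets
    ([fourier_has_cderive]). Finally, multiplication by a trigonometric
    polynomial corresponds to a finite combination of translates of T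
    ([is_fourier_trig]), and the sum rules are transported by a computation
    with congruences which uses the periodicity of U ([sum_rules_conj]). *)

(** * Derivatives of complex-valued functions of a real variable *)

Lemma Re_mul (R : realType) (x y : R[i]) :
  complex.Re (x * y) = complex.Re x * complex.Re y - complex.Im x * complex.Im y.
Proof. by case: x y => [a b] [c d]. Qed.

Lemma Im_mul (R : realType) (x y : R[i]) :
  complex.Im (x * y) = complex.Re x * complex.Im y + complex.Im x * complex.Re y.
Proof. by case: x y => [a b] [c d]. Qed.

Lemma Re_add (R : realType) (x y : R[i]) :
  complex.Re (x + y) = complex.Re x + complex.Re y.
Proof. by case: x y => [a b] [c d]. Qed.

Lemma Im_add (R : realType) (x y : R[i]) :
  complex.Im (x + y) = complex.Im x + complex.Im y.
Proof. by case: x y => [a b] [c d]. Qed.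

Section ComplexDerivative.
Variable R : realType.
Implicit Types (f g : R -> R[i]) (x y : R) (l : R[i]).

(** The relational form of [cderivable 0] together with [cderive 1]: unlike
    the total function, it composes under the rules of calculus without side
    conditions. *)
Definition has_cderive f x l :=
  is_derive x 1 (fun t => complex.Re (f t)) (complex.Re l) /\
  is_derive x 1 (fun t => complex.Im (f t)) (complex.Im l).

Lemma has_cderive_cderivable f x l : has_cderive f x l -> cderivable 0 f x.
Proof. by case=> -[? _] [? _]; split. Qed.

Lemma has_cderive_val f x l : has_cderive f x l -> cderive 1 f x = l.
Proof.
case=> -[_ h1] [_ h2]; rewrite /cderive !derive1n1 !derive1E h1 h2.
by case: (l).
Qed.

Lemma cderivable_has f x : cderivable 0 f x -> has_cderive f x (cderive 1 f x).
Proof.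
case=> d1 d2; rewrite /cderive !derive1n1 !derive1E /=.
by split; apply: DeriveDef.
Qed.

Lemma has_cderiveD f g x l k : has_cderive f x l -> has_cderive g x k ->
  has_cderive (fun t => f t + g t) x (l + k).
Proof.
move=> [f1 f2] [g1 g2]; split.
  rewrite Re_add; under eq_fun do rewrite Re_add.
  exact: is_deriveD.
rewrite Im_add; under eq_fun do rewrite Im_add.
exact: is_deriveD.
Qed.

Lemma has_cderiveM f g x l k : has_cderive f x l -> has_cderive g x k ->
  has_cderive (fun t => f t * g t) x (l * g x + f x * k).
Proof.
move=> [f1 f2] [g1 g2]; split.
  under eq_fun do rewrite Re_mul.
  have h := is_deriveB (is_deriveM f1 g1) (is_deriveM f2 g2).
  by apply: (is_derive_eq h); rewrite /GRing.scale /= Re_add !Re_mul; ring.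
under eq_fun do rewrite Im_mul.
have h := is_deriveD (is_deriveM f1 g2) (is_deriveM f2 g1).
by apply: (is_derive_eq h); rewrite /GRing.scale /= Im_add !Im_mul; ring.
Qed.

Lemma has_cderive_cst (c : R[i]) x : has_cderive (fun=> c) x 0.
Proof. by split; exact: is_derive_cst. Qed.

Lemma has_cderive_dilate f (d : R) x l : has_cderive f (d * x) l ->
  has_cderive (fun t => f (d * t)) x (d%:C * l).
Proof.
have dd : is_derive x 1 (fun t : R => d * t) d.
  by apply: is_derive_eq; rewrite /GRing.scale /= mulr1 ?mulr0 ?addr0.
move=> [f1 f2]; split.
  apply: is_derive_eq.
    exact: (is_derive1_comp (f := fun t => complex.Re (f t))).
  by rewrite Re_mul /= mul0r subr0 /GRing.scale /= mulrC.
apply: is_derive_eq.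
  exact: (is_derive1_comp (f := fun t => complex.Im (f t))).
by rewrite Im_mul /= mul0r addr0 /GRing.scale /= mulrC.
Qed.

Lemma has_cderive_expi (c x : R) :
  has_cderive (fun t => expi (c * t)) x (('i%C * c%:C) * expi (c * x)).
Proof.
rewrite -mulrA mulrCA; apply: (@has_cderive_dilate (@expi R)); split => /=.
  by rewrite mul0r sub0r mul1r; apply: is_derive_cos.
by rewrite mul0r mul1r add0r; apply: is_derive_sin.
Qed.

Lemma has_cderive_near f g x l : (\forall t \near x, f t = g t) ->
  has_cderive f x l -> has_cderive g x l.
Proof.
move=> fg [h1 h2]; split.
  by apply: near_eq_is_derive h1; near do congr complex.Re.
by apply: near_eq_is_derive h2; near do congr complex.Im.
Unshelve. all: by end_near. Qed.

Lemma cderiveSn n f : cderive n.+1 f = cderive n (cderive 1 f).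
Proof. by apply/funext => x; rewrite /cderive !derive1Sn. Qed.

Lemma cderivableSn n f x : cderivable n.+1 f x = cderivable n (cderive 1 f) x.
Proof. by rewrite /cderivable !derive1Sn. Qed.

Lemma cderive0 f : cderive 0 f = f.
Proof. by apply/funext => x; rewrite /cderive /=; case: (f x). Qed.

End ComplexDerivative.

(** * Smoothness at a point *)

Section Smoothness.
Variable R : realType.
Implicit Types (f g : R -> R[i]) (x y : R) (l : R[i]).

Definition smooth_at f x := forall n, \forall y \near x, cderivable n f y.

Lemma smoothP f : smooth f <-> forall x, smooth_at f x.
Proof.
split=> [sf x n|sf n x]; first by near=> y; exact: sf.
exact: nbhs_singleton (sf x n).
Unshelve. all: by end_near. Qed.

Lemma smooth_near0E f : smooth_near0 f = smooth_at f 0.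
Proof. by []. Qed.

(** Existence of n + 1 derivatives near x, by recursion on the derivative
    instead of on the order. In this form the Leibniz rule preserves it by
    induction: the derivative of f g is a sum of two products to which the
    induction hypothesis applies. *)
Fixpoint diff_near n f x : Prop :=
  (\forall y \near x, cderivable 0 f y) /\
  if n is k.+1 then diff_near k (cderive 1 f) x else True.

Lemma diff_near_derivable n f x : diff_near n f x ->
  \forall y \near x, cderivable 0 f y.
Proof. by case: n => [|n] []. Qed.

Lemma smooth_at_diff_near f x : smooth_at f x <-> forall n, diff_near n f x.
Proof.
split=> [sf n|sf n].
  elim: n f sf => [|n IH] f sf; first by split=> //; exact: (sf 0%N).
  split; first exact: (sf 0%N).
  by apply: IH => k; apply: filterS (sf k.+1) => y; rewrite cderivableSn.
elim: n f sf => [|n IH] f sf; first exact: (sf 0%N).1.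
suff: \forall y \near x, cderivable n (cderive 1 f) y.
  by apply: filterS => y; rewrite cderivableSn.
by apply: IH => k; exact: (sf k.+1).2.
Qed.

Lemma diff_nearW n f x : diff_near n.+1 f x -> diff_near n f x.
Proof.
elim: n f => [|n IH] f; first by case=> + _.
by move=> [h1 h2]; split=> //; apply: IH.
Qed.

Lemma near_cderivable f g x : (\forall y \near x, f y = g y) ->
  (\forall y \near x, cderivable 0 f y) ->
  \forall y \near x, cderivable 0 g y /\ cderive 1 g y = cderive 1 f y.
Proof.
move=> /near_join fg df.
near=> y.
have hf : cderivable 0 f y by near: y.
have h : has_cderive g y (cderive 1 f y).
  by apply: has_cderive_near (cderivable_has hf); near: y.
by split; [exact: has_cderive_cderivable h|exact: has_cderive_val h].
Unshelve. all: by end_near. Qed.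

Lemma diff_near_ext n f g x : (\forall y \near x, f y = g y) ->
  diff_near n f x -> diff_near n g x.
Proof.
elim: n f g => [|n IH] f g fg [df Cf]; have h := near_cderivable fg df.
  by split; [apply: filterS h => y []|].
split; first by apply: filterS h => y [].
by apply: IH Cf; apply: filterS h => y [].
Qed.

(** A derivative may be replaced by any function equal to it near x, which
    is how the rules of calculus enter the inductions below. *)
Lemma diff_nearS n f g x : (\forall y \near x, has_cderive f y (g y)) ->
  diff_near n g x -> diff_near n.+1 f x.
Proof.
move=> fg Cg; split; first by apply: filterS fg => y; exact: has_cderive_cderivable.
by apply: diff_near_ext Cg; apply: filterS fg => y /has_cderive_val.
Qed.

Lemma diff_near_has n f x : diff_near n f x ->
  \forall y \near x, has_cderive f y (cderive 1 f y).
Proof. by move/diff_near_derivable; apply: filterS => y; exact: cderivable_has. Qed.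

Lemma diff_nearD n f g x : diff_near n f x -> diff_near n g x ->
  diff_near n (fun t => f t + g t) x.
Proof.
elim: n f g => [|n IH] f g Cf Cg.
  split=> //; apply: filterS2 (diff_near_has Cf) (diff_near_has Cg) => y df dg.
  exact: has_cderive_cderivable (has_cderiveD df dg).
apply: diff_nearS (IH _ _ Cf.2 Cg.2).
by apply: filterS2 (diff_near_has Cf) (diff_near_has Cg) => y; exact: has_cderiveD.
Qed.

Lemma diff_nearM n f g x : diff_near n f x -> diff_near n g x ->
  diff_near n (fun t => f t * g t) x.
Proof.
elim: n f g => [|n IH] f g Cf Cg.
  split=> //; apply: filterS2 (diff_near_has Cf) (diff_near_has Cg) => y df dg.
  exact: has_cderive_cderivable (has_cderiveM df dg).
apply: diff_nearS
  (diff_nearD (IH _ _ Cf.2 (diff_nearW Cg)) (IH _ _ (diff_nearW Cf) Cg.2)).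
by apply: filterS2 (diff_near_has Cf) (diff_near_has Cg) => y; exact: has_cderiveM.
Qed.

Lemma diff_near_cst n c x : diff_near n (fun=> c) x.
Proof.
elim: n c => [|n IH] c.
  by split=> //; near=> y; exact: has_cderive_cderivable (has_cderive_cst _ _).
by apply: diff_nearS (IH 0); near=> y; exact: has_cderive_cst.
Unshelve. all: by end_near. Qed.

Lemma near_dilate (d x : R) (P : R -> Prop) :
  (\forall y \near d * x, P y) -> \forall y \near x, P (d * y).
Proof.
have : {for x, continuous (fun t : R => d * t)} by exact: mulrl_continuous.
by move/(_ P).
Qed.

Lemma diff_near_dilate n d f x : diff_near n f (d * x) ->
  diff_near n (fun t => f (d * t)) x.
Proof.
elim: n f => [|n IH] f Cf; have h := near_dilate (diff_near_has Cf).
  split=> //; apply: filterS h => y /has_cderive_dilate.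
  exact: has_cderive_cderivable.
apply: diff_nearS (diff_nearM (diff_near_cst n d%:C x) (IH _ Cf.2)).
by apply: filterS h => y /has_cderive_dilate.
Qed.

Lemma diff_near_expi n c x : diff_near n (fun t => expi (c * t)) x.
Proof.
elim: n => [|n IH].
  by split=> //; near=> y; exact: has_cderive_cderivable (has_cderive_expi _ _).
apply: diff_nearS (diff_nearM (diff_near_cst n _ x) IH).
by near=> y; exact: has_cderive_expi.
Unshelve. all: by end_near. Qed.

Lemma smooth_atD f g x : smooth_at f x -> smooth_at g x ->
  smooth_at (fun t => f t + g t) x.
Proof.
move=> /smooth_at_diff_near sf /smooth_at_diff_near sg.
by apply/smooth_at_diff_near => n; exact: diff_nearD.
Qed.

Lemma smooth_atM f g x : smooth_at f x -> smooth_at g x ->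
  smooth_at (fun t => f t * g t) x.
Proof.
move=> /smooth_at_diff_near sf /smooth_at_diff_near sg.
by apply/smooth_at_diff_near => n; exact: diff_nearM.
Qed.

Lemma smooth_at_cst c x : smooth_at (fun=> c) x.
Proof. by apply/smooth_at_diff_near => n; exact: diff_near_cst. Qed.

Lemma smooth_at_expi c x : smooth_at (fun t => expi (c * t)) x.
Proof. by apply/smooth_at_diff_near => n; exact: diff_near_expi. Qed.

Lemma smooth_at_dilate d f x : smooth_at f (d * x) ->
  smooth_at (fun t => f (d * t)) x.
Proof.
move=> /smooth_at_diff_near sf; apply/smooth_at_diff_near => n.
exact: diff_near_dilate.
Qed.

Lemma smooth_at_has f x : smooth_at f x ->
  \forall y \near x, has_cderive f y (cderive 1 f y).
Proof. by move=> /(_ 0%N); apply: filterS => y; exact: cderivable_has. Qed.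

Lemma smooth_at_cderive f x : smooth_at f x -> smooth_at (cderive 1 f) x.
Proof. by move=> sf n; apply: filterS (sf n.+1) => y; rewrite cderivableSn. Qed.

Lemma smooth_atS f g x : (\forall y \near x, has_cderive f y (g y)) ->
  smooth_at g x -> smooth_at f x.
Proof.
move=> fg /smooth_at_diff_near Cg; apply/smooth_at_diff_near => n.
by apply: diff_nearW; exact: diff_nearS fg _.
Qed.

Lemma smooth_at_sum I (s : seq I) (F : I -> R -> R[i]) x :
  (forall i, smooth_at (F i) x) -> smooth_at (fun t => \sum_(i <- s) F i t) x.
Proof.
move=> sF; elim: s => [|i s IH].
  by under eq_fun do rewrite big_nil; exact: smooth_at_cst.
by under eq_fun do rewrite big_cons; exact: (smooth_atD (sF i) IH).
Qed.

Lemma near_cderive n f g x : (\forall y \near x, f y = g y) -> smooth_at f x ->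
  cderive n f x = cderive n g x.
Proof.
elim: n f g => [|n IH] f g fg sf; first by rewrite !cderive0; exact: nbhs_singleton fg.
rewrite (cderiveSn n f) (cderiveSn n g); apply: IH; last exact: smooth_at_cderive.
by apply: filterS (near_cderivable fg (sf 0%N)) => y [].
Qed.

(** The basis of all computations of higher derivatives: derivatives at x see
    only the germ at x, so one may differentiate a formula for the first
    derivative which holds near x. *)
Lemma cderive_near_Sn n f g x : (\forall y \near x, has_cderive f y (g y)) ->
  smooth_at g x -> cderive n.+1 f x = cderive n g x.
Proof.
move=> fg sg; rewrite (cderiveSn n); apply/esym; apply: near_cderive => //.
by apply: filterS fg => y /has_cderive_val.
Qed.

Lemma cderiveD n f g x : smooth_at f x -> smooth_at g x ->
  cderive n (fun t => f t + g t) x = cderive n f x + cderive n g x.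
Proof.
elim: n f g => [|n IH] f g sf sg; first by rewrite !cderive0.
rewrite (@cderive_near_Sn n _ (fun t => cderive 1 f t + cderive 1 g t)).
- rewrite (IH _ _ (smooth_at_cderive sf) (smooth_at_cderive sg)).
  by rewrite (cderiveSn n f) (cderiveSn n g).
- apply: filterS2 (smooth_at_has sf) (smooth_at_has sg) => y.
  exact: has_cderiveD.
- by apply: smooth_atD; exact: smooth_at_cderive.
Qed.

Lemma cderive_cst n c x : cderive n.+1 (fun=> c) x = 0.
Proof.
elim: n c => [|n IH] c; first exact: has_cderive_val (has_cderive_cst _ _).
rewrite (@cderive_near_Sn _ _ (fun=> 0)) ?IH //; last exact: smooth_at_cst.
by near=> y; exact: has_cderive_cst.
Unshelve. all: by end_near. Qed.

Lemma cderiveZ n c f x : smooth_at f x ->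
  cderive n (fun t => c * f t) x = c * cderive n f x.
Proof.
elim: n f => [|n IH] f sf; first by rewrite !cderive0.
rewrite (@cderive_near_Sn n _ (fun t => c * cderive 1 f t)).
- by rewrite (IH _ (smooth_at_cderive sf)) (cderiveSn n f).
- apply: filterS (smooth_at_has sf) => y df.
  rewrite -[_ * cderive 1 f _]add0r -[0](mul0r (f y)).
  exact: has_cderiveM (has_cderive_cst _ _) df.
- by apply: smooth_atM; [exact: smooth_at_cst|exact: smooth_at_cderive].
Qed.

Lemma cderive_dilate n d f x : smooth_at f (d * x) ->
  cderive n (fun t => f (d * t)) x = d%:C ^+ n * cderive n f (d * x).
Proof.
elim: n f => [|n IH] f sf; first by rewrite !cderive0 mul1r.
rewrite (@cderive_near_Sn n _ (fun t => d%:C * cderive 1 f (d * t))).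
- rewrite cderiveZ; last exact/smooth_at_dilate/smooth_at_cderive.
  by rewrite (IH _ (smooth_at_cderive sf)) (cderiveSn n f) exprS mulrA.
- by have := near_dilate (smooth_at_has sf); apply: filterS => y /has_cderive_dilate.
- apply: smooth_atM; first exact: smooth_at_cst.
  exact/smooth_at_dilate/smooth_at_cderive.
Qed.

End Smoothness.

(** * Taylor jets as elements of a truncated polynomial ring *)

Section Jets.
Variable R : realType.
Implicit Types (f g : R -> R[i]) (P Q : {poly R[i]}).

(** The factorials stand on the side of the coefficients of P so that
    formal and analytic derivatives correspond without divisions. *)
Definition has_jet N f P := forall k, (k < N)%N -> P`_k *+ k`! = cderive k f 0.

Definition taylor N f : {poly R[i]} := \poly_(k < N) (cderive k f 0 / k`!%:R).

Lemma has_jet_taylor N f : has_jet N f (taylor N f).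
Proof.
by move=> k kN; rewrite coef_poly kN -[LHS]mulr_natr divfK.
Qed.

Lemma has_jet_uniq N f P Q k : has_jet N f P -> has_jet N f Q -> (k < N)%N ->
  P`_k = Q`_k.
Proof.
move=> fP fQ kN; have /eqP := fP k kN; rewrite -(fQ k kN).
by rewrite -subr_eq0 -mulrnBl mulrn_eq0 gtn_eqF ?fact_gt0 //= subr_eq0 => /eqP.
Qed.

Lemma has_jetD N f g P Q : smooth_at f 0 -> smooth_at g 0 ->
  has_jet N f P -> has_jet N g Q -> has_jet N (fun t => f t + g t) (P + Q).
Proof.
by move=> sf sg fP gQ k kN; rewrite coefD mulrnDl fP // gQ // cderiveD.
Qed.

(** The Leibniz formula without binomial coefficients: by induction on the
    order, applied to the derivative of the product on both sides. The
    coefficient of degree k + 1 of P Q is read off its formal derivative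
    P' Q + P Q'. *)
Lemma has_jetM N f g P Q : smooth_at f 0 -> smooth_at g 0 ->
  has_jet N f P -> has_jet N g Q -> has_jet N (fun t => f t * g t) (P * Q).
Proof.
elim: N f g P Q => [//|N IH] f g P Q sf sg fP gQ [_|k].
  have := fP 0%N isT; have := gQ 0%N isT.
  by rewrite coef0M !cderive0 => <- <-.
have low h S : has_jet N.+1 h S -> has_jet N h S.
  by move=> hS j jN; apply: hS; exact: ltnW.
have der h S : has_jet N.+1 h S -> has_jet N (cderive 1 h) S^`().
  by move=> hS j jN; rewrite coef_deriv -mulrnA -factS hS // (cderiveSn j).
rewrite ltnS => kN.
have sf' := smooth_at_cderive sf; have sg' := smooth_at_cderive sg.
rewrite (@cderive_near_Sn _ _ _ (fun t => cderive 1 f t * g t + f t * cderive 1 g t)).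
- rewrite factS mulrnA -coef_deriv derivM.
  have fgP := IH _ _ _ _ sf' sg (der _ _ fP) (low _ _ gQ).
  have fgQ := IH _ _ _ _ sf sg' (low _ _ fP) (der _ _ gQ).
  exact: (has_jetD (smooth_atM sf' sg) (smooth_atM sf sg') fgP fgQ kN).
- by apply: filterS2 (smooth_at_has sf) (smooth_at_has sg) => y; exact: has_cderiveM.
- exact: (smooth_atD (smooth_atM sf' sg) (smooth_atM sf sg')).
Qed.

Lemma has_jet_cst N c : has_jet N (fun=> c) c%:P.
Proof.
move=> [|k] kN; first by rewrite coefC eqxx cderive0.
by rewrite coefC mul0rn cderive_cst.
Qed.

Definition jet N f : {poly %/ ('X ^+ N.+1 : {poly R[i]})} :=
  in_qpoly ('X ^+ N.+1) (taylor N.+1 f).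

Lemma in_qpolyXn_eq N P Q : (in_qpoly ('X ^+ N.+1) P = in_qpoly ('X ^+ N.+1) Q) <->
  (forall k, (k < N.+1)%N -> P`_k = Q`_k).
Proof.
have E S : val (in_qpoly ('X ^+ N.+1) S) = take_poly N.+1 S.
  by rewrite /= mk_monic_Xn Pdiv.RingMonic.take_poly_rmodp.
split=> [h k kN|h].
  have := congr1 (fun S : {poly %/ _} => (val S)`_k) h.
  by rewrite !E !coef_take_poly kN.
apply: val_inj; rewrite !E; apply/polyP => k; rewrite !coef_take_poly.
by case: ifP => // kN; exact: h.
Qed.

Lemma jetP N f P : has_jet N.+1 f P -> jet N f = in_qpoly ('X ^+ N.+1) P.
Proof.
move=> fP; apply/in_qpolyXn_eq => k; apply: has_jet_uniq fP.
exact: has_jet_taylor.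
Qed.

Lemma jetD N f g : smooth_at f 0 -> smooth_at g 0 ->
  jet N (fun t => f t + g t) = jet N f + jet N g.
Proof.
move=> sf sg; rewrite /jet -rmorphD; apply: jetP.
by apply: has_jetD => //; exact: has_jet_taylor.
Qed.

Lemma jetM N f g : smooth_at f 0 -> smooth_at g 0 ->
  jet N (fun t => f t * g t) = jet N f * jet N g.
Proof.
move=> sf sg; rewrite /jet -rmorphM; apply: jetP.
by apply: has_jetM => //; exact: has_jet_taylor.
Qed.

Lemma jet0 N : jet N (fun=> 0) = 0.
Proof. by rewrite (jetP (@has_jet_cst N.+1 0)) rmorph0. Qed.

Lemma jet1 N : jet N (fun=> 1) = 1.
Proof. by rewrite (jetP (@has_jet_cst N.+1 1)) rmorph1. Qed.

Lemma jet_sum N I (s : seq I) (F : I -> R -> R[i]) :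
  (forall i, smooth_at (F i) 0) ->
  jet N (fun t => \sum_(i <- s) F i t) = \sum_(i <- s) jet N (F i).
Proof.
move=> sF; elim: s => [|i s IH].
  by under eq_fun do rewrite big_nil; rewrite jet0 big_nil.
under eq_fun do rewrite big_cons.
by rewrite big_cons -IH jetD //; exact: smooth_at_sum.
Qed.

(** Agreement to a lower order m is congruence modulo x^m, which allows the
    two orders m and n of the theorem to be treated in a single ring. *)
Lemma jet_eqmod N m f g : (m <= N.+1)%N ->
  (forall k, (k < m)%N -> cderive k f 0 = cderive k g 0) <->
  exists z, jet N f = jet N g + in_qpoly ('X ^+ N.+1) 'X^m * z.
Proof.
move=> mN; split=> [fg|[z]].
  set P := taylor N.+1 f - taylor N.+1 g.
  exists (in_qpoly ('X ^+ N.+1) (drop_poly m P)).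
  rewrite /jet -rmorphM -rmorphD; congr in_qpoly.
  suff P0 : take_poly m P = 0.
    rewrite mulrC -[_ * 'X^m]add0r -P0 poly_take_drop /P addrC subrK //.
  apply/polyP => k; rewrite coef_take_poly coef0 /P; case: ifP => // km.
  by rewrite coefB !coef_poly (leq_trans km) // fg // subrr.
have -> : z = in_qpoly ('X ^+ N.+1) (val z).
  apply: val_inj => /=; rewrite Pdiv.CommonRing.rmodp_small //.
  exact: size_mk_monic.
rewrite /jet -rmorphM -rmorphD => /in_qpolyXn_eq h k km.
have kN := leq_trans km mN.
rewrite -(@has_jet_taylor N.+1 f k kN) -(@has_jet_taylor N.+1 g k kN) h //.
by rewrite coefD coefXnM km addr0.
Qed.

(** The ring of jets is local: an element is invertible as soon as its
    constant coefficient is. *)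
Lemma jet_unit N f : f 0 != 0 -> exists c, jet N f * c = 1.
Proof.
move=> f0; exists (qpoly_inv (jet N f)); apply: qpoly_mulzV.
have : (val (jet N f)).[0] != 0.
  rewrite horner_coef0 /= mk_monic_Xn -Pdiv.RingMonic.take_poly_rmodp.
  by rewrite coef_take_poly /= coef_poly /= cderive0 divr1.
have cop (p : {poly R[i]}) : p.[0] != 0 -> coprimep (mk_monic ('X ^+ N.+1)) p.
  move=> p0; rewrite mk_monic_Xn coprimep_pexpl // coprimep_sym coprimepX.
  by [].
exact: cop.
Qed.

End Jets.

(** * Trigonometric polynomials *)

Lemma expiD (R : realType) (x y : R) : expi (x + y) = expi x * expi y.
Proof.
rewrite /expi cosD sinD; apply/eqP; rewrite eq_complex /=.
by rewrite [_ + sin x * _]addrC [sin x * _ + _ ]addrC !eqxx.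
Qed.

Lemma expi0 (R : realType) : expi (0 : R) = 1.
Proof. by rewrite /expi cos0 sin0. Qed.

Lemma expi_period (R : realType) (x : R) (k : int) (l : nat) :
  expi (- (k%:~R * (x + 2 * pi * l%:R))) = expi (- (k%:~R * x)).
Proof.
have per n (y : R) : expi (y + pi *+ 2 *+ n) = expi y.
  elim: n => [|n IH]; first by rewrite mulr0n addr0.
  by rewrite mulrS [_ + _ *+ n]addrC addrA -IH /expi cosD2pi sinD2pi.
have perz (j : int) (y : R) : expi (y + pi *+ 2 *~ j) = expi y.
  case: j => n; first exact: per.
  by rewrite NegzE mulrNz -(per n.+1 (y - _)) subrK.
rewrite -(perz (k * l%:Z) (- _)); congr expi.
rewrite mulrzA -[in RHS]mulrzl -[pi *+ 2]mulr_natl.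
rewrite -[_ *~ k]mulrzl -[l%:R]/(l%:Z%:~R) -[_ *~ l]mulrzl.
ring.
Qed.

Section TrigPoly.
Variable R : realType.
Implicit Types (f g : R -> R[i]).

(** Lists with possibly repeated frequencies make sums and products immediate,
    in contrast to finitely supported functions. *)
Definition trig f := exists s : seq (int * R[i]),
  forall xi, f xi = \sum_(x <- s) x.2 * expi (- (x.1%:~R * xi)).

Lemma trig_cst c : trig (fun=> c).
Proof.
by exists [:: (0, c)] => xi; rewrite big_seq1 /= mul0r oppr0 expi0 mulr1.
Qed.

Lemma trigD f g : trig f -> trig g -> trig (fun t => f t + g t).
Proof.
by move=> [s fs] [u gu]; exists (s ++ u) => xi; rewrite big_cat fs gu.
Qed.

Lemma trigM f g : trig f -> trig g -> trig (fun t => f t * g t).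
Proof.
move=> [s fs] [u gu].
exists [seq (x.1 + y.1, x.2 * y.2) | x <- s, y <- u] => xi.
rewrite big_allpairs_dep /= fs gu mulr_suml; apply: eq_bigr => x _.
rewrite mulr_sumr; apply: eq_bigr => y _.
by rewrite intrD mulrDl opprD expiD mulrACA.
Qed.

Lemma trig_sum I (s : seq I) (F : I -> R -> R[i]) :
  (forall i, trig (F i)) -> trig (fun t => \sum_(i <- s) F i t).
Proof.
move=> tF; elim: s => [|i s IH].
  by under eq_fun do rewrite big_nil; exact: trig_cst.
by under eq_fun do rewrite big_cons; exact: (trigD (tF i) IH).
Qed.

Lemma trig_dilate (d : nat) f : trig f -> trig (fun t => f (d%:R * t)).
Proof.
move=> [s fs]; exists [seq (x.1 * d%:Z, x.2) | x <- s] => xi.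
rewrite fs big_map; apply: eq_bigr => x _ /=.
by rewrite intrM mulrA.
Qed.

Lemma trig_expi : trig (@expi R).
Proof.
by exists [:: (-1, 1)] => xi; rewrite big_seq1 /= mul1r mulN1r opprK.
Qed.

Lemma trig_smooth f c x : trig f -> smooth_at (fun t => f (t + c)) x.
Proof.
move=> [s fs]; under eq_fun do rewrite fs.
apply: smooth_at_sum => y.
have -> : (fun t => y.2 * expi (- (y.1%:~R * (t + c)))) =
          (fun t => (y.2 * expi (- (y.1%:~R * c))) * expi ((- y.1%:~R) * t)).
  apply/funext => t; rewrite mulrDr opprD addrC expiD mulrA; congr (_ * expi _).
  by rewrite mulNr.
exact: smooth_atM (smooth_at_cst _ _) (smooth_at_expi _ _).
Qed.

Lemma trig_smooth0 f : trig f -> smooth_at f 0.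
Proof.
move=> tf; have := @trig_smooth f 0 0 tf.
by under eq_fun do rewrite addr0.
Qed.

Lemma trig_period f (x : R) (l : nat) : trig f -> f (x + 2 * pi * l%:R) = f x.
Proof. by move=> [s fs]; rewrite !fs; apply: eq_bigr => y _; rewrite expi_period. Qed.

(** Every finite jet is realized by a trigonometric polynomial, one
    coefficient at a time: s = exp(i t) - 1 vanishes to order exactly one at 0,
    so adding a multiple of s^N adjusts the coefficient of degree N and
    none of lower degree. *)
Lemma trig_has_jet N (P : {poly R[i]}) : exists2 f, trig f & has_jet N f P.
Proof.
elim: N => [|N [f tf fP]]; first by exists (fun=> 0) => //; exact: trig_cst.
pose s t : R[i] := expi t - 1.
have ts : trig s by exact: trigD trig_expi (trig_cst _).
have ss := trig_smooth0 ts.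
have [Q [s0 sQ]] : exists Q : {poly R[i]}, Q`_0 = 'i%C /\ has_jet N.+1 s ('X * Q).
  have T0 := @has_jet_taylor R N.+2 s 0%N isT; have T1 := @has_jet_taylor R N.+2 s 1%N isT.
  exists (drop_poly 1 (taylor N.+2 s)); split.
    rewrite coef_drop_poly; rewrite mulr1n in T1; rewrite T1.
    have := has_cderiveD (has_cderive_expi 1 0) (has_cderive_cst (-1 : R[i]) 0).
    under [fun _ => _]eq_fun do rewrite mul1r.
    by move/has_cderive_val ->; rewrite mulr0 expi0 !mulr1 addr0.
  have -> : 'X * drop_poly 1 (taylor N.+2 s) = taylor N.+2 s.
    rewrite -[RHS](poly_take_drop 1) mulrC -[LHS]add0r; congr (_ + _).
    apply/polyP => k; rewrite coef0 coef_take_poly; case: k => [|k] //=.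
    by move: T0; rewrite mulr1n => ->; rewrite cderive0 /s expi0 subrr.
  by move=> k kN; apply: has_jet_taylor; exact: ltnW.
have sX k : trig (fun t => s t ^+ k) /\
            has_jet N.+1 (fun t => s t ^+ k) ('X ^+ k * Q ^+ k).
  elim: k => [|k [tk ak]].
    by split; [exact: trig_cst|rewrite mulr1; exact: has_jet_cst].
  under eq_fun do rewrite exprS.
  split; first exact: trigM.
  rewrite !exprS mulrACA.
  exact: (has_jetM ss (trig_smooth0 tk) sQ ak).
have [tN aN] := sX N.
(* The leading coefficient of s^N is i^N. *)
pose c := (P`_N - (taylor N.+1 f)`_N) / 'i%C ^+ N.
exists (fun t => f t + c * s t ^+ N).
  by apply: trigD => //; apply: trigM => //; exact: trig_cst.
have A : has_jet N.+1 (fun t => f t + c * s t ^+ N)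
    (taylor N.+1 f + c%:P * ('X ^+ N * Q ^+ N)).
  apply: has_jetD; first exact: trig_smooth0.
  - by apply: trig_smooth0; apply: trigM => //; exact: trig_cst.
  - exact: has_jet_taylor.
  - exact: (has_jetM (smooth_at_cst c 0) (trig_smooth0 tN) (@has_jet_cst R N.+1 c) aN).
move=> k kN; rewrite -(A k kN); congr (_ *+ _).
rewrite coefD coefCM coefXnM; move: kN; rewrite ltnS leq_eqVlt => /predU1P[->|kN].
  rewrite ltnn subnn -[(Q ^+ N)`_0]horner_coef0 horner_exp horner_coef0 s0.
  by rewrite divfK ?expf_neq0 ?neq0Ci // addrC subrK.
rewrite kN mulr0 addr0; apply/esym; apply: (@has_jet_uniq _ N f _ _ k _ fP kN) => j jN.
by apply: has_jet_taylor; exact: ltnW.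
Qed.

(** Sending 0 to the zero function keeps disjoint supports disjoint, on which
    the invertibility of lifted shears depends. *)
Lemma jet_trig N (z : {poly %/ ('X ^+ N.+1 : {poly R[i]})}) :
  exists f, [/\ trig f, jet N f = z & z = 0 -> f = fun=> 0].
Proof.
have [->|z0] := eqVneq z 0.
  by exists (fun=> 0); split=> //; [exact: trig_cst|exact: jet0].
have [f tf fz] := trig_has_jet N.+1 (val z).
exists f; split=> //; last by move/eqP; rewrite (negbTE z0).
rewrite (jetP fz); apply: val_inj => /=; apply: Pdiv.CommonRing.rmodp_small.
exact: size_mk_monic.
Qed.

End TrigPoly.

(** * Jets of matrices and congruences modulo powers *)

Section MatrixJets.
Variable R : realType.
Local Notation C := R[i].
Local Notation jets N := {poly %/ ('X ^+ N.+1 : {poly R[i]})}.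

Definition mxjet N p q (F : R -> 'M[C]_(p, q)) : 'M[jets N]_(p, q) :=
  \matrix_(i, j) jet N (fun t => F t i j).

Lemma mx_smoothM p q s (F : R -> 'M[C]_(p, q)) (G : R -> 'M[C]_(q, s)) :
  mx_smooth_near0 F -> mx_smooth_near0 G ->
  mx_smooth_near0 (fun t => F t *m G t).
Proof.
move=> sF sG i j; rewrite smooth_near0E.
under eq_fun do rewrite mxE.
by apply: smooth_at_sum => k; exact: (smooth_atM (sF i k) (sG k j)).
Qed.

Lemma mxjetM N p q s (F : R -> 'M[C]_(p, q)) (G : R -> 'M[C]_(q, s)) :
  mx_smooth_near0 F -> mx_smooth_near0 G ->
  mxjet N (fun t => F t *m G t) = mxjet N F *m mxjet N G.
Proof.
move=> sF sG; apply/matrixP => i j; rewrite !mxE.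
under eq_fun do rewrite mxE.
rewrite jet_sum => [|k]; last exact: (smooth_atM (sF i k) (sG k j)).
by apply: eq_bigr => k _; rewrite !mxE (jetM N (sF i k) (sG k j)).
Qed.

Lemma mxjet1 N p : mxjet N (fun=> 1%:M : 'M[C]_p) = 1%:M.
Proof.
apply/matrixP => i j; rewrite !mxE.
by case: (i == j); [exact: jet1|exact: jet0].
Qed.

Lemma eqO_mxjet N m p q (F G : R -> 'M[C]_(p, q)) : (m <= N.+1)%N ->
  eqO m F G <->
  exists Z, mxjet N F = mxjet N G + in_qpoly ('X ^+ N.+1) 'X^m *: Z.
Proof.
move=> mN; split=> [FG|[Z FG] k km i j].
  have /choice[z Hz] : forall ij : 'I_p * 'I_q, exists z,
      jet N (fun t => F t ij.1 ij.2) =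
      jet N (fun t => G t ij.1 ij.2) + in_qpoly ('X ^+ N.+1) 'X^m * z.
    move=> [i j]; apply/jet_eqmod => // k km; exact: FG.
  exists (\matrix_(i, j) z (i, j)); apply/matrixP => i j.
  by rewrite !mxE; exact: (Hz (i, j)).
have [_ /(_ _ k km)] := @jet_eqmod R N m (fun t => F t i j) (fun t => G t i j) mN.
by apply; exists (Z i j); have /matrixP/(_ i j) := FG; rewrite !mxE.
Qed.

Lemma eqO_transitive m p q (F G H : R -> 'M[C]_(p, q)) :
  eqO m F G -> eqO m G H -> eqO m F H.
Proof. by move=> FG GH k km i j; rewrite FG // GH. Qed.

Lemma eqO_symmetric m p q (F G : R -> 'M[C]_(p, q)) : eqO m F G -> eqO m G F.
Proof. by move=> FG k km i j; rewrite FG. Qed.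

Lemma eqO_ext m p q (F G : R -> 'M[C]_(p, q)) : F =1 G -> eqO m F G.
Proof. by move=> /funext ->. Qed.

(** Congruence modulo x^m in the ring of jets is compatible with products. *)
Lemma eqO_mulmx m p q s (F F' : R -> 'M[C]_(p, q)) (G G' : R -> 'M[C]_(q, s)) :
  mx_smooth_near0 F -> mx_smooth_near0 F' ->
  mx_smooth_near0 G -> mx_smooth_near0 G' ->
  eqO m F F' -> eqO m G G' ->
  eqO m (fun t => F t *m G t) (fun t => F' t *m G' t).
Proof.
move=> sF sF' sG sG' /(eqO_mxjet _ _ (leqnSn m))[Z FF'].
move=> /(eqO_mxjet _ _ (leqnSn m))[W GG'].
apply/(eqO_mxjet _ _ (leqnSn m)).
exists (Z *m mxjet m G + mxjet m F' *m W).
rewrite !mxjetM // scalerDr {1}FF' mulmxDl {1}GG' mulmxDr -scalemxAl -scalemxAr.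
by rewrite -addrA [X in _ + X = _]addrC.
Qed.

Lemma mx_smooth_dilate p q (F : R -> 'M[C]_(p, q)) (d : R) :
  mx_smooth_near0 F -> mx_smooth_near0 (fun t => F (d * t)).
Proof.
move=> sF i j; have := sF i j; rewrite !smooth_near0E.
by rewrite -{1}[0](mulr0 d) => /smooth_at_dilate.
Qed.

Lemma cderive_dilate0 n d (f : R -> C) : smooth_near0 f ->
  cderive n (fun t => f (d * t)) 0 = d%:C ^+ n * cderive n f 0.
Proof.
rewrite smooth_near0E -{1}[0](mulr0 d) => sf.
by rewrite cderive_dilate // mulr0.
Qed.

Lemma eqO_dilate m p q (F G : R -> 'M[C]_(p, q)) (d : R) :
  mx_smooth_near0 F -> mx_smooth_near0 G -> eqO m F G ->
  eqO m (fun t => F (d * t)) (fun t => G (d * t)).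
Proof.
move=> sF sG FG k km i j.
by rewrite (cderive_dilate0 k d (sF i j)) (cderive_dilate0 k d (sG i j)) FG.
Qed.

(** Dilation by d multiplies the k-th Taylor coefficient by d^k, and d^k <> 1
    for k > 0. *)
Lemma eqO_dilate_cst m d p q (F : R -> 'M[C]_(p, q)) : (2 <= d)%N ->
  mx_smooth_near0 F -> eqO m (fun t => F (d%:R * t)) F -> eqO m F (fun=> F 0).
Proof.
move=> d2 sF dF [|k] km i j; first by rewrite !cderive0.
rewrite cderive_cst; have /eqP := dF _ km i j.
rewrite (cderive_dilate0 k.+1 d%:R (sF i j)) -subr_eq0 -{2}[cderive _ _ _]mul1r.
rewrite -mulrBl mulf_eq0 subr_eq0 => /orP[|/eqP //].
rewrite rmorph_nat -natrX -[1](mulr1n 1) eqr_nat -[X in _ == X](expn0 d).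
by rewrite eqn_exp2l.
Qed.

Lemma eqO_reflexive m p q (F : R -> 'M[C]_(p, q)) : eqO m F F.
Proof. by []. Qed.

End MatrixJets.

Arguments eqO_reflexive {R m p q} F.
Arguments eqO_ext {R m p q F G} _.
Arguments eqO_symmetric {R m p q F G} _.
Arguments eqO_transitive {R m p q F G H} _ _.
Arguments eqO_mulmx {R m p q s F F' G G'} _ _ _ _ _ _.
Arguments eqO_dilate {R m p q F G} d _ _ _.

(** * Matrices of trigonometric polynomials *)

Section TrigMatrices.
Variable R : realType.
Local Notation C := R[i].

Lemma symbol_seq p q (L : seq (int * 'M[C]_(p, q))) : exists u : l0 R p q,
  forall xi, symbol u xi = \sum_(x <- L) expi (- (x.1%:~R * xi)) *: x.2.
Proof.
pose K := [fset k | k in [seq x.1 | x <- L]]%fset.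
pose c k := \sum_(x <- L | x.1 == k) x.2.
exists [fsfun k in K => c k] => xi.
rewrite /symbol (@big_fset_incl _ _ _ _ _ K) /=; first last.
- by move=> k _; rewrite mem_finsupp negbK => /eqP ->; rewrite scaler0.
- by apply/fsubsetP => k; rewrite mem_finsupp fsfunE; case: ifP => //; rewrite eqxx.
rewrite big_seq; under eq_bigr => k kK.
  rewrite fsfunE kK /c scaler_sumr; over.
rewrite -big_seq (exchange_big_dep xpredT) //= big_seq [RHS]big_seq.
apply: eq_bigr => x xL.
rewrite big_mkcond (bigD1_seq x.1) ?fset_uniq //=; last first.
  by rewrite !inE; apply/mapP; exists x.
rewrite eqxx big1 ?addr0 // => k /negbTE kx.
by rewrite eq_sym kx.
Qed.

Lemma trig_poly_mxP p q (F : R -> 'M[C]_(p, q)) :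
  trig_poly_mx F <-> forall i j, trig (fun t => F t i j).
Proof.
split=> [[u Fu] i j|tF].
  exists [seq (k, u k i j) | k <- finsupp u] => xi.
  rewrite Fu /symbol summxE big_map; apply: eq_bigr => k _.
  by rewrite mxE mulrC.
have /choice[s Hs] : forall ij : 'I_p * 'I_q, exists s : seq (int * C),
    forall xi, F xi ij.1 ij.2 = \sum_(x <- s) x.2 * expi (- (x.1%:~R * xi)).
  by move=> [i j]; exact: tF.
have [u Hu] := symbol_seq [seq (x.1, x.2 *: delta_mx ij.1 ij.2) |
  ij <- enum {: 'I_p * 'I_q}, x <- s ij].
exists u => xi; rewrite Hu big_allpairs_dep /= big_enum /=.
rewrite [LHS]matrix_sum_delta pair_big /=; apply: eq_bigr => -[i j] _ /=.
rewrite (Hs (i, j)) scaler_suml; apply: eq_bigr => x _ /=.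
by rewrite scalerA mulrC.
Qed.

Definition trig_mx p q (F : R -> 'M[C]_(p, q)) :=
  forall i j, trig (fun t => F t i j).

Lemma trig_mxM p q s (F : R -> 'M[C]_(p, q)) (G : R -> 'M[C]_(q, s)) :
  trig_mx F -> trig_mx G -> trig_mx (fun t => F t *m G t).
Proof.
move=> tF tG i j; under eq_fun do rewrite mxE.
by apply: trig_sum => k; exact: (trigM (tF i k) (tG k j)).
Qed.

Lemma trig_mx_smooth p q (F : R -> 'M[C]_(p, q)) : trig_mx F -> mx_smooth_near0 F.
Proof. by move=> tF i j; exact: trig_smooth0 (tF i j). Qed.

Lemma trig_mx_shift p q (F : R -> 'M[C]_(p, q)) c :
  trig_mx F -> mx_smooth_near0 (fun t => F (t + c)).
Proof. by move=> tF i j; exact: (trig_smooth c 0 (tF i j)). Qed.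

Lemma trig_mx_symbol p q (u : l0 R p q) : trig_mx (symbol u).
Proof. by apply/trig_poly_mxP; exists u. Qed.

End TrigMatrices.

(** * Transitivity of elementary matrices on dual pairs *)

Section Elementary.
Variables (A : comNzRingType) (r : nat).

(** The pairs (g, g^-1) for g in the group generated by shears; carrying the
    inverse along makes the lift to trigonometric polynomials invertible by
    construction. Disjoint supports are required entrywise, rather than
    y *m x = 0, because it is the former that survives lifting. *)
Inductive elementary : 'M[A]_r -> 'M[A]_r -> Prop :=
| elementary_shear (x : 'cV[A]_r) (y : 'rV[A]_r) :
    (forall i, x i 0 = 0 \/ y 0 i = 0) ->
    elementary (1%:M + x *m y) (1%:M - x *m y)
| elementary_mul g h g' h' : elementary g h -> elementary g' h' ->
    elementary (g *m g') (h' *m h).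

Lemma disjoint_mulmx (B : pzRingType) (x : 'cV[B]_r) (y : 'rV[B]_r) :
  (forall i, x i 0 = 0 \/ y 0 i = 0) -> y *m x = 0.
Proof.
move=> xy; apply/matrixP => i j; rewrite !mxE big1 // => k _.
by rewrite !ord1; case: (xy k) => ->; rewrite ?mulr0 ?mul0r.
Qed.

Lemma shear_inv (B : pzRingType) (x : 'cV[B]_r) (y : 'rV[B]_r) :
  y *m x = 0 -> (1%:M + x *m y) *m (1%:M - x *m y) = 1%:M.
Proof.
move=> yx; rewrite mulmxDl mul1mx mulmxBr mulmx1 mulmxA -(mulmxA x) yx.
by rewrite mulmx0 mul0mx subr0 subrK.
Qed.

Lemma elementary_inv g h : elementary g h -> h *m g = 1%:M.
Proof.
elim=> [x y xy|g1 h1 g2 h2 _ IH1 _ IH2].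
  have := @shear_inv A (- x) y; rewrite mulmxN mulNmx opprK.
  by apply; rewrite disjoint_mulmx ?oppr0.
by rewrite mulmxA -(mulmxA h2) IH1 mulmx1.
Qed.

Lemma elementary_sym g h : elementary g h -> elementary h g.
Proof.
elim=> [x y xy|g1 h1 g2 h2 _ IH1 _ IH2]; last exact: elementary_mul.
have := @elementary_shear (- x) y; rewrite mulNmx opprK; apply => i.
by rewrite mxE; case: (xy i) => ->; [left; rewrite oppr0|right].
Qed.

Lemma mul_delta (l k : 'I_r) (u : 'cV[A]_r) :
  delta_mx (0 : 'I_1) l *m u = (u l 0)%:M.
Proof.
by rewrite -rowE; apply/matrixP => i j; rewrite !ord1 !mxE eqxx mulr1n.
Qed.

(** Adding c (1 - u_l) times the entry k to the entry l gives 1. *)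
Lemma elementary_entry1 (u : 'cV[A]_r) (k l : 'I_r) c : k != l ->
  u k 0 * c = 1 -> exists g h, elementary g h /\ (g *m u) l 0 = 1.
Proof.
move=> kl uc; pose x : 'cV[A]_r := (c * (1 - u l 0)) *: delta_mx l 0.
exists (1%:M + x *m delta_mx 0 k), (1%:M - x *m delta_mx 0 k); split.
  apply: elementary_shear => i; rewrite !mxE.
  case: (eqVneq i l) => [->|il]; [right|left]; last by rewrite mulr0.
  by rewrite eqxx eq_sym (negbTE kl).
rewrite mulmxDl mul1mx -mulmxA mul_delta // mul_mx_scalar !mxE !eqxx mulr1.
by rewrite mulrA uc mul1r addrC subrK.
Qed.

(** The first shear turns u into the basis vector of index l. Since the
    pairing with the row is preserved, the row then has entry 1 at l, and the
    second shear, which fixes that basis vector, clears its other entries. *)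
Lemma elementary_normal (u : 'cV[A]_r) (v : 'rV[A]_r) (l : 'I_r) :
  u l 0 = 1 -> v *m u = 1%:M -> exists g h,
  [/\ elementary g h, g *m u = delta_mx l 0 & v *m h = delta_mx 0 l].
Proof.
move=> ul vu.
pose x : 'cV[A]_r := delta_mx l 0 - u; pose y : 'rV[A]_r := delta_mx 0 l.
have xy i : x i 0 = 0 \/ y 0 i = 0.
  rewrite /x /y !mxE; case: (eqVneq i l) => [->|il]; [left|right].
    by rewrite ul subrr.
  by rewrite eqxx.
set g := 1%:M + x *m y; set h := 1%:M - x *m y.
have E : elementary g h by exact: elementary_shear.
have gu : g *m u = delta_mx l 0.
  by rewrite mulmxDl mul1mx -mulmxA mul_delta // ul mulmx1 addrC subrK.
set w := v *m h.
have wl : w *m delta_mx l 0 = 1%:M.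
  by rewrite -gu mulmxA -(mulmxA v) (elementary_inv E) mulmx1.
pose y' : 'rV[A]_r := w - delta_mx 0 l.
have xy' i : (delta_mx l 0 : 'cV[A]_r) i 0 = 0 \/ y' 0 i = 0.
  rewrite /y' !mxE; case: (eqVneq i l) => [->|il]; [right|by left].
  move: wl => /matrixP/(_ 0 0); rewrite -colE !mxE => ->.
  by rewrite !eqxx subrr.
have E' := elementary_shear xy'.
exists ((1%:M + delta_mx l 0 *m y') *m g), (h *m (1%:M - delta_mx l 0 *m y')).
split; first exact: elementary_mul.
  rewrite -mulmxA gu mulmxDl mul1mx -mulmxA (disjoint_mulmx xy').
  by rewrite mulmx0 addr0.
rewrite mulmxA -/w mulmxBr mulmx1 mulmxA wl mul1mx /y'.
by rewrite opprB addrC subrK.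
Qed.

(** If the invertible entry of u is the entry l itself, a different entry is
    first made equal to 1; this is where two entries are needed. *)
Lemma elementary_to_basis (u : 'cV[A]_r) (v : 'rV[A]_r) (k l : 'I_r) c :
  (2 <= r)%N -> u k 0 * c = 1 -> v *m u = 1%:M -> exists g h,
  [/\ elementary g h, g *m u = delta_mx l 0 & v *m h = delta_mx 0 l].
Proof.
move=> r2 uc vu.
have [g [h [E gl]]] : exists g h, elementary g h /\ (g *m u) l 0 = 1.
  have [kl|] := eqVneq k l; last by move=> kl; exact: elementary_entry1 kl uc.
  have [k' k'l] : exists k' : 'I_r, k' != l.
    case: (eqVneq (l : nat) 0%N) => l0.
      by exists (Ordinal r2); rewrite -val_eqE /= l0.
    by exists (Ordinal (ltnW r2)); rewrite -val_eqE /= eq_sym.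
  have kk' : k != k' by rewrite kl eq_sym.
  have [g [h [E gk]]] := elementary_entry1 kk' uc.
  have [|g' [h' [E' gl']]] := @elementary_entry1 (g *m u) _ _ 1 k'l.
    by rewrite mulr1.
  exists (g' *m g), (h *m h'); split; first exact: elementary_mul.
  by rewrite -mulmxA.
have vhgu : (v *m h) *m (g *m u) = 1%:M.
  by rewrite mulmxA -(mulmxA v) (elementary_inv E) mulmx1.
have [g' [h' [E' gu vh]]] := elementary_normal gl vhgu.
exists (g' *m g), (h *m h'); split; first exact: elementary_mul.
  by rewrite -mulmxA.
by rewrite mulmxA.
Qed.

Lemma elementary_transitive (u u' : 'cV[A]_r) (v v' : 'rV[A]_r) k k' c c' :
  (2 <= r)%N -> u k 0 * c = 1 -> u' k' 0 * c' = 1 ->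
  v *m u = 1%:M -> v' *m u' = 1%:M -> exists g h,
  [/\ elementary g h, g *m u = u' & v *m h = v'].
Proof.
move=> r2 uc uc' vu vu'.
have [g [h [E gu vh]]] := elementary_to_basis k r2 uc vu.
have [g' [h' [E' gu' vh']]] := elementary_to_basis k r2 uc' vu'.
have F := elementary_inv E'.
exists (h' *m g), (h *m g'); split.
- by apply: elementary_mul => //; exact: elementary_sym.
- by rewrite -mulmxA gu -gu' mulmxA F mul1mx.
by rewrite mulmxA vh -vh' -mulmxA F mulmx1.
Qed.

End Elementary.

(** * Existence of the strongly invertible matrix *)

Section Existence.
Variable R : realType.
Local Notation C := R[i].
Local Notation jets N := {poly %/ ('X ^+ N.+1 : {poly R[i]})}.

Lemma jetN N (f : R -> C) : smooth_at f 0 -> jet N (fun t => - f t) = - jet N f.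
Proof.
move=> sf; have sN : smooth_at (fun t => - f t) 0.
  under eq_fun do rewrite -mulN1r.
  exact: smooth_atM (smooth_at_cst _ _) sf.
apply/eqP; rewrite -addr_eq0 -(jetD N sN sf).
by under eq_fun do rewrite addNr; rewrite jet0.
Qed.

Lemma lift_jets N p q (x : 'M[jets N]_(p, q)) : exists X : R -> 'M[C]_(p, q),
  [/\ trig_mx X, mxjet N X = x & forall i j, x i j = 0 -> forall t, X t i j = 0].
Proof.
have /choice[f Hf] : forall ij : 'I_p * 'I_q, exists f,
    [/\ trig f, jet N f = x ij.1 ij.2 & x ij.1 ij.2 = 0 -> f = fun=> 0].
  by move=> ij; exact: jet_trig.
exists (fun t => \matrix_(i, j) f (i, j) t).
have E i j : (fun t => (\matrix_(i, j) f (i, j) t) i j) = f (i, j).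
  by apply/funext => t; rewrite mxE.
split=> [i j||i j x0 t].
- by rewrite E; case: (Hf (i, j)).
- by apply/matrixP => i j; rewrite mxE E; case: (Hf (i, j)).
by rewrite mxE; case: (Hf (i, j)) => _ _ /(_ x0) ->.
Qed.

Lemma shear_trig r (X : R -> 'cV[C]_r) (Y : R -> 'rV[C]_r) :
  trig_mx X -> trig_mx Y -> trig_mx (fun t => 1%:M + X t *m Y t).
Proof.
move=> tX tY i j; under eq_fun do rewrite mxE.
exact: trigD (trig_cst _) (trig_mxM tX tY i j).
Qed.

Lemma mxjet_shear N r (X : R -> 'cV[C]_r) (Y : R -> 'rV[C]_r) :
  trig_mx X -> trig_mx Y ->
  mxjet N (fun t => 1%:M + X t *m Y t) = 1%:M + mxjet N X *m mxjet N Y.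
Proof.
move=> tX tY.
rewrite -(mxjetM N (trig_mx_smooth tX) (trig_mx_smooth tY)) -(mxjet1 R N).
apply/matrixP => i j; rewrite [LHS]mxE [RHS]mxE; under eq_fun do rewrite mxE.
rewrite [X in X + _]mxE [X in _ + X]mxE.
exact: jetD (smooth_at_cst _ _) (trig_smooth0 (trig_mxM tX tY i j)).
Qed.

(** A shear lifts to a shear, whose inverse is again one; products follow. *)
Lemma elementary_lift N r (g h : 'M[jets N]_r) : elementary g h ->
  exists F H : R -> 'M[C]_r, [/\ trig_mx F, trig_mx H,
    forall t, F t *m H t = 1%:M, mxjet N F = g & mxjet N H = h].
Proof.
elim=> [x y xy|g1 h1 g2 h2 _ [F1 [H1 [tF1 tH1 FH1 jF1 jH1]]] _
    [F2 [H2 [tF2 tH2 FH2 jF2 jH2]]]]; last first.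
  exists (fun t => F1 t *m F2 t), (fun t => H2 t *m H1 t); split.
  - exact: trig_mxM.
  - exact: trig_mxM.
  - by move=> t; rewrite mulmxA -(mulmxA (F1 t)) FH2 mulmx1 FH1.
  - by rewrite mxjetM ?jF1 ?jF2 //; exact: trig_mx_smooth.
  - by rewrite mxjetM ?jH1 ?jH2 //; exact: trig_mx_smooth.
have [X [tX jX X0]] := lift_jets x; have [Y [tY jY Y0]] := lift_jets y.
have YX t : Y t *m X t = 0.
  by apply: disjoint_mulmx => i; case: (xy i) => [/X0|/Y0]; [left|right].
have tX' : trig_mx (fun t => - X t).
  move=> i j; under eq_fun do rewrite mxE -mulN1r.
  exact: trigM (trig_cst _) (tX i j).
have jX' : mxjet N (fun t => - X t) = - x.
  rewrite -jX; apply/matrixP => i j; rewrite !mxE; under eq_fun do rewrite mxE.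
  exact: jetN (trig_smooth0 (tX i j)).
exists (fun t => 1%:M + X t *m Y t), (fun t => 1%:M + - X t *m Y t); split.
- exact: shear_trig.
- exact: shear_trig.
- by move=> t; rewrite mulNmx shear_inv.
- by rewrite mxjet_shear // jX jY.
by rewrite mxjet_shear // jX' jY mulNmx.
Qed.

(** With s = v u = 1 + x z, the factor c = s^-1 normalizes the pairing, and
    both c and s are 1 modulo x^m. An entry of u is invertible since u(0) <> 0
    because v(0) u(0) = 1. *)
Lemma unit_pairing N m r (v : R -> 'rV[C]_r) (u : R -> 'cV[C]_r) :
  (0 < m <= N.+1)%N -> mx_smooth_near0 v -> mx_smooth_near0 u ->
  eqO m (fun t => v t *m u t) (fun=> 1%:M) ->
  let x := in_qpoly ('X ^+ N.+1) 'X^m : jets N in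
  exists c z w, [/\ (c *: mxjet N v) *m mxjet N u = 1%:M,
    c = 1 + x * w,
    mxjet N v = (1 + x * z) *: (c *: mxjet N v)
    & exists k e, mxjet N u k 0 * e = 1].
Proof.
move=> /andP[m0 mN] sv su vu x.
have [Z HZ] := (eqO_mxjet _ _ mN).1 vu.
rewrite mxjetM // mxjet1 in HZ.
have vu0 : v 0 *m u 0 = 1%:M.
  by apply/matrixP => i j; have := vu _ m0 i j; rewrite !cderive0.
pose s := 1 + x * Z 0 0.
have sE : mxjet N v *m mxjet N u = s%:M.
  by rewrite HZ; apply/matrixP => i j; rewrite !ord1 !mxE /s !mulr1n.
have [c sc] : exists c, s * c = 1.
  have := @jet_unit R N (fun t => (v t *m u t) 0 0).
  rewrite vu0 mxE oner_eq0 => /(_ isT)[c]; exists c; rewrite -[RHS]p; congr (_ * c).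
  have /matrixP/(_ 0 0) := sE; rewrite -(mxjetM N sv su) !mxE mulr1n => <-.
  by [].
exists c, (Z 0 0), (- (Z 0 0 * c)); split.
- by rewrite -scalemxAl sE scale_scalar_mx mulrC sc.
- rewrite mulrN mulrA; apply/eqP; rewrite -subr_eq opprK -{1}[c]mul1r -mulrDl.
  by rewrite -/s sc.
- by rewrite scalerA -/s sc scale1r.
have [k uk] : exists k, u 0 k 0 != 0.
  apply/existsP; apply: contraT; rewrite negb_exists => /forallP u0.
  have /matrixP/(_ 0 0)/eqP := vu0; rewrite !mxE big1 1?eq_sym ?oner_eq0 // => k _.
  by have := u0 k; rewrite negbK => /eqP ->; rewrite mulr0.
have [e ue] := @jet_unit R N (fun t => u t k 0) uk.
by exists k, e; rewrite mxE.
Qed.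

Lemma exists_strongly_invertible m n r (v v' : R -> 'rV[C]_r)
    (u u' : R -> 'cV[C]_r) : (2 <= r)%N -> (0 < m)%N ->
  mx_smooth_near0 v -> mx_smooth_near0 v' ->
  mx_smooth_near0 u -> mx_smooth_near0 u' ->
  eqO m (fun t => v t *m u t) (fun=> 1%:M) ->
  eqO m (fun t => v' t *m u' t) (fun=> 1%:M) ->
  exists U, [/\ strongly_invertible U,
    eqO m (fun t => v t *m invmx (U t)) v' & eqO n (fun t => U t *m u t) u'].
Proof.
move=> r2 m0 sv sv' su su' vu vu'; pose N := maxn m n.
have mN : (m <= N.+1)%N by rewrite ltnW // ltnS leq_maxl.
have nN : (n <= N.+1)%N by rewrite ltnW // ltnS leq_maxr.
have m0N : (0 < m <= N.+1)%N by rewrite m0.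
have [c [z [_ [V1 _ Vz [k [e ue]]]]]] := unit_pairing m0N sv su vu.
have [c' [_ [w [V1' c'w _ [k' [e' ue']]]]]] := unit_pairing m0N sv' su' vu'.
have [g [h [E gu vh]]] := elementary_transitive r2 ue ue' V1 V1'.
have [F [H [tF tH FH jF jH]]] := elementary_lift E.
have FU t : F t \in unitmx by have /mulmx1_unit[] := FH t.
have FI t : invmx (F t) = H t.
  by rewrite -[LHS]mulmx1 -(FH t) mulmxA mulVmx // mul1mx.
exists F; split.
- split=> //; first exact/trig_poly_mxP.
  by apply/trig_poly_mxP => i j; under eq_fun do rewrite FI; exact: tH.
- have -> : (fun t => v t *m invmx (F t)) = (fun t => v t *m H t).
    by apply/funext => t; rewrite FI.
  apply/(eqO_mxjet _ _ mN).
  rewrite mxjetM ?jH //; last exact: trig_mx_smooth.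
  rewrite Vz -scalemxAl vh {1}c'w scalerA.
  set x := in_qpoly _ _.
  exists ((z + w + x * z * w) *: mxjet N v').
  rewrite scalerA -[X in _ = X + _]scale1r -scalerDl; congr (_ *: _).
  by rewrite mulrDl mulrDr !mul1r; ring.
apply/(eqO_mxjet _ _ nN); exists 0.
rewrite scaler0 addr0 mxjetM ?jF //; exact: trig_mx_smooth.
Qed.

End Existence.
(** * Bounds for the complex exponential and for derivatives *)

Import ComplexField.Normc.

Section NormcBounds.
Variable R : realType.
Implicit Types z w : R[i].

Lemma normc_ge0 z : 0 <= normc z.
Proof. by case: z => a b; exact: sqrtr_ge0. Qed.

Lemma normcD z w : normc (z + w) <= normc z + normc w.
Proof. exact: le_normcD. Qed.

Lemma normc_le z : normc z <= `|complex.Re z| + `|complex.Im z|.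
Proof.
case: z => a b /=; rewrite -[leRHS]ger0_norm ?addr_ge0 // -sqrtr_sqr.
rewrite ler_wsqrtr // sqrrD !real_normK ?num_real //.
by rewrite lerD2r lerDl mulrn_wge0 // mulr_ge0.
Qed.

Lemma Re_le_normc z : `|complex.Re z| <= normc z.
Proof. by case: z => a b /=; rewrite -sqrtr_sqr ler_wsqrtr // lerDl sqr_ge0. Qed.

Lemma Im_le_normc z : `|complex.Im z| <= normc z.
Proof. by case: z => a b /=; rewrite -sqrtr_sqr ler_wsqrtr // lerDr sqr_ge0. Qed.

Lemma normc_real (a : R) : normc a%:C = `|a|.
Proof. by rewrite /= expr0n addr0 sqrtr_sqr. Qed.

Lemma normc_i : normc ('i%C : R[i]) = 1.
Proof. by rewrite /= expr0n add0r expr1n sqrtr1. Qed.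

Lemma normc_expi (t : R) : normc (expi t) = 1.
Proof. by rewrite /= cos2Dsin2 sqrtr1. Qed.

Lemma normcX z n : normc (z ^+ n) = normc z ^+ n.
Proof. by elim: n => [|n IH]; rewrite ?normc1 // !exprS normcM IH. Qed.

Lemma norm_le_mvt0 (f df : R -> R) (x B : R) : f 0 = 0 ->
  (forall t : R, is_derive t 1 f (df t)) ->
  (forall t, `|t| <= `|x| -> `|df t| <= B) -> `|f x| <= B * `|x|.
Proof.
move=> f0 fdf dB.
have cf : continuous f.
  move=> t; apply/differentiable_continuous/derivable1_diffP.
  by case: (fdf t).
have [x0|x0] := leP 0 x.
  have [c] := MVT_segment x0 (fun t _ => fdf t) (continuous_subspaceT cf).
  rewrite in_itv /= => /andP[c0 cx]; rewrite f0 !subr0 => ->.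
  by rewrite normrM ler_wpM2r // dB // !ger0_norm.
have [c] := MVT_segment (ltW x0) (fun t _ => fdf t) (continuous_subspaceT cf).
rewrite in_itv /= => /andP[xc c0]; rewrite f0 !sub0r mulrN => /eqP.
rewrite eqr_opp => /eqP ->; rewrite normrM ler_wpM2r // dB //.
by rewrite !ler0_norm ?lerN2 // ltW.
Qed.

Lemma norm_sin_le (t : R) : `|sin t| <= `|t|.
Proof.
rewrite -[leRHS]mul1r; apply: (@norm_le_mvt0 (@sin R) (@cos R) t 1); first exact: sin0.
by move=> s _; rewrite ler_norml cos_geN1 cos_le1.
Qed.

Lemma is_derive_cosB1 (t : R) : is_derive t 1 (fun s : R => cos s - 1) (- sin t).
Proof.
have h := is_deriveB (is_derive_cos t) (is_derive_cst (1 : R) t 1).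
by apply: (is_derive_eq h); rewrite subr0.
Qed.

Lemma norm_cosB1_le (t : R) : `|cos t - 1| <= `|t|.
Proof.
rewrite -[leRHS]mul1r.
apply: (@norm_le_mvt0 (fun s => cos s - 1) (fun s => - sin s) t 1).
- by rewrite cos0 subrr.
- exact: is_derive_cosB1.
by move=> s _; rewrite normrN ler_norml sin_geN1 sin_le1.
Qed.

Lemma norm_cosB1_le2 (t : R) : `|cos t - 1| <= `|t| * `|t|.
Proof.
apply: (@norm_le_mvt0 (fun s => cos s - 1) (fun s => - sin s) t `|t|).
- by rewrite cos0 subrr.
- exact: is_derive_cosB1.
by move=> s st; rewrite normrN (le_trans (norm_sin_le s)).
Qed.

Lemma norm_sinB_le2 (t : R) : `|sin t - t| <= `|t| * `|t|.
Proof.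
apply: (@norm_le_mvt0 (fun s => sin s - s) (fun s => cos s - 1) t `|t|).
- by rewrite sin0 subrr.
by move=> s st; rewrite (le_trans (norm_cosB1_le s)).
Qed.

Lemma normc_expiB1 (t : R) : normc (expi t - 1) <= `|t| *+ 2.
Proof.
apply: le_trans (normc_le _) _; rewrite /= subr0 mulr2n.
by rewrite lerD // ?norm_cosB1_le ?norm_sin_le.
Qed.

Lemma normc_expiB1B (t : R) : normc (expi t - 1 - 'i%C * t%:C) <= t ^+ 2 *+ 2.
Proof.
apply: le_trans (normc_le _) _.
rewrite -real_normK ?num_real // expr2 mulr2n.
rewrite /= !(mul0r, mul1r, mulr0, subr0, oppr0, addr0, add0r).
by rewrite lerD // ?norm_cosB1_le2 ?norm_sinB_le2.
Qed.

(** Differentiability from a quadratic bound on the remainder, the form in which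
    the continuity estimate of a distribution provides it. *)
Lemma is_derive_quadratic (f : R -> R) (x l K : R) :
  (forall h, `|h| <= 1 -> `|f (h + x) - f x - h * l| <= K * h ^+ 2) ->
  is_derive x 1 f l.
Proof.
move=> fl.
have cv : h^-1 *: (f (h *: (1 : R) + x) - f x) @[h --> 0^'] --> l.
  apply/cvgrPdist_le => e e0; near=> h.
  have h0 : h != 0 by near: h; exact: nbhs_dnbhs_neq.
  have h1 : `|h| <= 1 by near: h; exact: dnbhs0_le.
  have K0 : 0 < `|K| + 1 by rewrite ltr_wpDl.
  have he : `|h| <= e / (`|K| + 1) by near: h; apply: dnbhs0_le; rewrite divr_gt0.
  rewrite /GRing.scale /= mulr1 distrC.
  have -> : h^-1 * (f (h + x) - f x) - l = h^-1 * (f (h + x) - f x - h * l).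
    by field.
  rewrite normrM normfV ler_pdivrMl ?normr_gt0 // (le_trans (fl h h1)) //.
  rewrite -real_normK ?num_real // expr2 mulrCA ler_wpM2l //.
  rewrite ler_pdivlMr // in he; apply: le_trans he.
  by rewrite mulrC ler_wpM2l // (le_trans (ler_norm _)) // lerDl.
apply: DeriveDef; last exact: cvg_lim cv.
by apply/cvg_ex; exists l.
Unshelve. all: by end_near. Qed.

Lemma has_cderive_quadratic (f : R -> R[i]) (x : R) (l : R[i]) (K : R) :
  (forall h : R, `|h| <= 1 -> normc (f (h + x) - f x - h%:C * l) <= K * h ^+ 2) ->
  has_cderive f x l.
Proof.
move=> fl; split; apply: (@is_derive_quadratic _ _ _ K) => h h1.
  apply: le_trans (fl h h1); apply: le_trans (Re_le_normc _).
  by case: (f _) (f _) (l) => [? ?] [? ?] [? ?] /=; rewrite mul0r subr0.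
apply: le_trans (fl h h1); apply: le_trans (Im_le_normc _).
by case: (f _) (f _) (l) => [? ?] [? ?] [? ?] /=; rewrite mul0r addr0.
Qed.

End NormcBounds.

(** * Compactly supported distributions and their Fourier transforms *)

Section Distributions.
Variable R : realType.
Implicit Types (f g chi : R -> R[i]) (T : cdistr R).

Definition derivs_le (N : nat) (M : R) f (B : R) :=
  forall n x, (n <= N)%N -> `|x| <= M -> normc (cderive n f x) <= B.

Lemma derivs_le_ge0 N M f B : 0 <= M -> derivs_le N M f B -> 0 <= B.
Proof.
move=> M0 fB; apply: le_trans (fB 0%N 0 (leq0n _) _); first exact: normc_ge0.
by rewrite normr0.
Qed.

(** With C and M nonnegative, any admissible bound B is nonnegative and the
    estimate can be used monotonically; enlarging M to be nonnegative makes
    the segment nonempty. *)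
Lemma cdistr_bound T : exists (C : R) (N : nat) (M : R), [/\ 0 <= C, 0 <= M &
  forall f B, smooth f -> derivs_le N M f B -> normc (T f) <= C * B].
Proof.
have [C [N [M TC]]] := cdistr_continuous T.
exists (Num.max C 0), N, (Num.max M 0); split; rewrite ?le_max ?lexx ?orbT //.
move=> f B sf fB; have B0 : 0 <= B.
  by apply: derivs_le_ge0 fB; rewrite le_max lexx orbT.
apply: (@le_trans _ _ (C * B)).
  by apply: TC => // n x nN xM; apply: fB => //; rewrite le_max xM.
by rewrite ler_wpM2r // le_max lexx.
Qed.

Lemma smooth_cst c : smooth (fun=> c : R[i]).
Proof. by apply/smoothP => x; exact: smooth_at_cst. Qed.

Lemma smoothD f g : smooth f -> smooth g -> smooth (fun x => f x + g x).
Proof.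
by move=> /smoothP sf /smoothP sg; apply/smoothP => x; exact: smooth_atD.
Qed.

Lemma smoothM f g : smooth f -> smooth g -> smooth (fun x => f x * g x).
Proof.
by move=> /smoothP sf /smoothP sg; apply/smoothP => x; exact: smooth_atM.
Qed.

Lemma smooth_cderive f : smooth f -> smooth (cderive 1 f).
Proof. by move=> /smoothP sf; apply/smoothP => x; exact: smooth_at_cderive. Qed.

Lemma smooth_expi (c : R) : smooth (fun x => expi (c * x)).
Proof. by apply/smoothP => x; exact: smooth_at_expi. Qed.

Lemma has_cderive_real x : has_cderive (fun t : R => t%:C) x 1.
Proof. by split; [exact: is_derive_id|exact: is_derive_cst]. Qed.

Lemma smooth_real : smooth (fun x : R => x%:C).
Proof.
apply/smoothP => x; apply: (@smooth_atS _ _ (fun=> 1)); last exact: smooth_at_cst.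
by near=> y; exact: has_cderive_real.
Unshelve. all: by end_near. Qed.

Lemma smooth_has f x : smooth f -> has_cderive f x (cderive 1 f x).
Proof. by move=> sf; apply: cderivable_has; exact: sf. Qed.

Lemma cderive_has_Sn n f g : (forall x, has_cderive f x (g x)) ->
  cderive n.+1 f = cderive n g.
Proof.
move=> fg; rewrite (cderiveSn n); congr (cderive n _).
by apply/funext => x; exact: has_cderive_val.
Qed.

(** The transpose of a continuous linear operator on smooth functions acts on
    distributions; multiplications and translations are the two instances. *)
Lemma cdistr_pull T (L : (R -> R[i]) -> (R -> R[i])) :
  (forall c f g, smooth f -> smooth g ->
     L (fun x => c * f x + g x) = (fun x => c * L f x + L g x)) ->
  (forall f, smooth f -> smooth (L f)) ->
  (forall N M, 0 <= M -> exists (K : R) (M' : R), [/\ 0 <= M' &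
     forall f B, smooth f -> derivs_le N M' f B -> derivs_le N M (L f) (K * B)]) ->
  exists S : cdistr R, forall f, S f = T (L f).
Proof.
move=> Llin Lsm Lb.
have lin c f g : smooth f -> smooth g ->
    T (L (fun x => c * f x + g x)) = c * T (L f) + T (L g).
  move=> sf sg; rewrite (Llin c f g sf sg).
  exact: (@cdistr_linear R T c _ _ (Lsm f sf) (Lsm g sg)).
have [C [N [M [C0 M0 TC]]]] := cdistr_bound T.
have [K [M' [M'0 LK]]] := Lb N M M0.
have cont : exists (C : R) (N : nat) (M : R), forall f (B : R), smooth f ->
    (forall n x, (n <= N)%N -> `|x| <= M -> normc (cderive n f x) <= B) ->
    normc (T (L f)) <= C * B.
  exists (C * K), N, M' => f B sf fB; rewrite -mulrA.
  by apply: TC; [exact: Lsm|exact: LK].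
by exists (@CDistr R (fun f => T (L f)) lin cont).
Qed.

Lemma smooth_bounded chi M : smooth chi ->
  exists K, 0 <= K /\ forall x, `|x| <= M -> normc (chi x) <= K.
Proof.
move=> schi.
have bnd (F : R -> R) : (forall x, derivable F x 1) ->
    exists K, forall x, `|x| <= M -> `|F x| <= K.
  move=> dF; have [M0|M0] := leP 0 M; last first.
    by exists 0 => x; rewrite leNgt (lt_le_trans M0).
  have cF : continuous F.
    by move=> t; apply/differentiable_continuous/derivable1_diffP.
  have cN : continuous (fun x => `|F x|).
    by move=> x; apply: continuous_comp; [exact: cF|exact: norm_continuous].
  have MM : - M <= M by rewrite (le_trans _ M0) // oppr_le0.
  have [c _ cmax] := EVT_max MM (continuous_subspaceT cN).
  by exists `|F c| => x xM; apply: cmax; rewrite in_itv /= -ler_norml.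
have [K HK] := bnd _ (fun x => (schi 0%N x).1).
have [L HL] := bnd _ (fun x => (schi 0%N x).2).
exists (`|K| + `|L|); split; first exact: addr_ge0.
move=> x xM; apply: le_trans (normc_le _) _.
by rewrite lerD // (le_trans _ (ler_norm _)) ?HK ?HL.
Qed.

(** Induction on the order through (chi f)' = chi' f + chi f' avoids the
    explicit Leibniz formula, at the price of a constant left implicit. *)
Lemma derivs_le_mul1 n M chi : smooth chi -> exists K, 0 <= K /\
  forall f B, smooth f -> derivs_le n M f B ->
  forall x, `|x| <= M -> normc (cderive n (fun t => chi t * f t) x) <= K * B.
Proof.
elim: n chi => [|n IH] chi schi.
  have [K [K0 HK]] := smooth_bounded M schi.
  exists K; split=> // f B sf fB x xM; rewrite cderive0 normcM.
  apply: ler_pM; rewrite ?normc_ge0 ?HK //.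
  by have := fB 0%N x (leqnn _) xM; rewrite cderive0.
have [K [K0 HK]] := IH chi schi.
have [L [L0 HL]] := IH _ (smooth_cderive schi).
exists (L + K); split; first exact: addr_ge0.
move=> f B sf fB x xM.
rewrite (@cderive_has_Sn n _
  (fun t => cderive 1 chi t * f t + chi t * cderive 1 f t)); last first.
  by move=> y; apply: has_cderiveM; exact: smooth_has.
have sf' := smooth_cderive sf; have schi' := smooth_cderive schi.
have [s1 s2] := (smoothM schi' sf, smoothM schi sf').
rewrite cderiveD; [|exact: (smoothP _).1 s1 x|exact: (smoothP _).1 s2 x].
apply: le_trans (normcD _ _) _; rewrite mulrDl lerD //.
  by apply: HL => // k y kn; apply: fB; exact: leqW.
apply: HK => // k y kn yM; rewrite -(cderiveSn k); exact: fB.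
Qed.

Lemma derivs_le_mul N M chi : 0 <= M -> smooth chi -> exists K, forall f B,
  smooth f -> derivs_le N M f B -> derivs_le N M (fun t => chi t * f t) (K * B).
Proof.
move=> M0 schi.
suff : exists K, 0 <= K /\ forall f B,
  smooth f -> derivs_le N M f B -> derivs_le N M (fun t => chi t * f t) (K * B).
  by move=> [K [_ ?]]; exists K.
elim: N => [|N [K [K0 HK]]].
  have [K [K0 HK]] := derivs_le_mul1 0 M schi; exists K; split=> // f B sf fB n x.
  by rewrite leqn0 => /eqP ->; exact: HK.
have [L [L0 HL]] := derivs_le_mul1 N.+1 M schi.
exists (K + L); split; first exact: addr_ge0.
move=> f B sf fB n x; have B0 := derivs_le_ge0 M0 fB.
rewrite leq_eqVlt => /predU1P[-> xM|nN xM].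
  by apply: le_trans (HL f B sf fB x xM) _; rewrite ler_wpM2r // lerDr.
apply: (@le_trans _ _ (K * B)); last by rewrite ler_wpM2r // lerDl.
by apply: HK => // k y kN; apply: fB; exact: leqW.
Qed.

Lemma cdistr_mul T chi : smooth chi ->
  exists S : cdistr R, forall f, S f = T (fun x => chi x * f x).
Proof.
move=> schi; apply: (@cdistr_pull T (fun f x => chi x * f x)).
- by move=> c f g sf sg; apply/funext => x; rewrite mulrDr mulrCA.
- by move=> f sf; exact: smoothM.
move=> N M M0; have [K HK] := derivs_le_mul N M0 schi.
by exists K, M.
Qed.

Lemma has_cderive_shift f (k x : R) l : has_cderive f (x + k) l ->
  has_cderive (fun t => f (t + k)) x l.
Proof.
have dd : is_derive x 1 (fun t : R => t + k) 1.
  have h := is_deriveD (is_derive_id x 1) (is_derive_cst k x 1).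
  by apply: (is_derive_eq h); rewrite addr0.
move=> [f1 f2]; split.
  have h := is_derive1_comp
    (f := fun t => complex.Re (f t)) (g := fun t => t + k) f1 dd.
  by apply: (is_derive_eq h); rewrite /GRing.scale /= mulr1.
have h := is_derive1_comp
    (f := fun t => complex.Im (f t)) (g := fun t => t + k) f2 dd.
by apply: (is_derive_eq h); rewrite /GRing.scale /= mulr1.
Qed.

Lemma cderive_shift n f k : smooth f ->
  cderive n (fun t => f (t + k)) = fun t => cderive n f (t + k).
Proof.
elim: n f => [|n IH] f sf; first by rewrite !cderive0.
rewrite (@cderive_has_Sn n _ (fun t => cderive 1 f (t + k))).
  by rewrite (IH _ (smooth_cderive sf)) (cderiveSn n f).
by move=> x; apply: has_cderive_shift; exact: smooth_has.
Qed.

Lemma smooth_shift f k : smooth f -> smooth (fun t => f (t + k)).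
Proof.
move=> sf n; elim: n f sf => [|n IH] f sf x.
  apply: has_cderive_cderivable; apply: has_cderive_shift; exact: smooth_has.
rewrite cderivableSn (_ : cderive 1 _ = fun t => cderive 1 f (t + k)).
  exact: IH (smooth_cderive sf) x.
by rewrite cderive_shift.
Qed.

Lemma cdistr_shift T k :
  exists S : cdistr R, forall f, S f = T (fun x => f (x + k)).
Proof.
apply: (@cdistr_pull T (fun f x => f (x + k))) => [c f g _ _ //|f sf|N M M0].
  exact: smooth_shift.
exists 1, (M + `|k|); split; first exact: addr_ge0.
move=> f B sf fB n x nN xM; rewrite mul1r cderive_shift //; apply: fB => //.
by rewrite (le_trans (ler_normD _ _)) // lerD2r.
Qed.

Lemma cdistr_add T1 T2 : exists S : cdistr R, forall f, S f = T1 f + T2 f.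
Proof.
have lin c f g : smooth f -> smooth g -> T1 (fun x => c * f x + g x) +
    T2 (fun x => c * f x + g x) = c * (T1 f + T2 f) + (T1 g + T2 g).
  by move=> sf sg; rewrite !cdistr_linear // mulrDr addrACA.
have [C1 [N1 [M1 [C10 M10 TC1]]]] := cdistr_bound T1.
have [C2 [N2 [M2 [C20 M20 TC2]]]] := cdistr_bound T2.
have cont : exists (C : R) (N : nat) (M : R), forall f (B : R), smooth f ->
    (forall n x, (n <= N)%N -> `|x| <= M -> normc (cderive n f x) <= B) ->
    normc (T1 f + T2 f) <= C * B.
  exists (C1 + C2), (maxn N1 N2), (Num.max M1 M2) => f B sf fB.
  apply: le_trans (normcD _ _) _; rewrite mulrDl lerD //.
    by apply: TC1 => // n x nN xM; apply: fB; rewrite ?leq_max ?nN // le_max xM.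
  apply: TC2 => // n x nN xM; apply: fB; rewrite ?leq_max ?nN ?orbT //.
  by rewrite le_max xM orbT.
by exists (@CDistr R (fun f => T1 f + T2 f) lin cont).
Qed.

Lemma cdistr0 T : T (fun=> 0) = 0.
Proof.
have := @cdistr_linear R T 1 (fun=> 0) (fun=> 0) (smooth_cst 0) (smooth_cst 0).
under eq_fun do rewrite mulr0 addr0.
by rewrite mul1r => /eqP; rewrite -subr_eq0 opprD addrA subrr sub0r oppr_eq0 => /eqP.
Qed.

Lemma cdistrZ T c f : smooth f -> T (fun x => c * f x) = c * T f.
Proof.
move=> sf; have := @cdistr_linear R T c f (fun=> 0) sf (smooth_cst 0).
by under eq_fun do rewrite addr0; rewrite cdistr0 addr0.
Qed.

Lemma fourierE T xi : fourier T xi = T (fun x => expi (- xi * x)).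
Proof.
rewrite /fourier; congr (cdistr_val T _); apply/funext => x.
by rewrite mulNr mulrC.
Qed.

Definition is_fourier f := exists T, fourier T =1 f.

Lemma is_fourierD f g : is_fourier f -> is_fourier g ->
  is_fourier (fun t => f t + g t).
Proof.
move=> [T Tf] [S Sg]; have [U HU] := cdistr_add T S.
by exists U => t; rewrite /fourier HU -/(fourier T t) -/(fourier S t) Tf Sg.
Qed.

Lemma is_fourier0 T : is_fourier (fun=> 0).
Proof.
have [S HS] := cdistr_mul T (smooth_cst 0); exists S => t; rewrite /fourier HS.
by under [fun _ => _]eq_fun do rewrite mul0r; rewrite cdistr0.
Qed.

(** Multiplying the transform by exp(- i k xi) amounts to translating T
    by k. *)
Lemma is_fourier_trig f T : trig f -> is_fourier (fun t => f t * fourier T t).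
Proof.
move=> [s fs]; have -> : (fun t => f t * fourier T t) =
  (fun t => \sum_(x <- s) x.2 * expi (- (x.1%:~R * t)) * fourier T t).
  by apply/funext => t; rewrite fs mulr_suml.
elim: s {f fs} => [|[k c] s IH].
  by under eq_fun do rewrite big_nil; exact: is_fourier0 T.
under eq_fun do rewrite big_cons.
apply: (is_fourierD _ IH) => /=.
have [S HS] := cdistr_shift T k%:~R.
have [U HU] := cdistr_mul S (smooth_cst c).
exists U => t; rewrite !fourierE HU HS -cdistrZ.
  congr (cdistr_val T _); apply/funext => x.
  by rewrite -mulrA -expiD; congr (_ * expi _); ring.
exact: smooth_expi.
Qed.

Lemma cderive_expi n (c : R) :
  cderive n (fun x => expi (c * x)) = fun x => ('i%C * c%:C) ^+ n * expi (c * x).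
Proof.
elim: n => [|n IH]; first by rewrite cderive0; apply/funext => x; rewrite mul1r.
rewrite (cderive_has_Sn _ (fun x => has_cderive_expi c x)).
apply/funext => x; rewrite cderiveZ; last exact: smooth_at_expi.
by rewrite IH exprS mulrA.
Qed.

Lemma smooth_expiB1B (c : R) :
  smooth (fun x : R => expi (c * x) - 1 - 'i%C * (c * x)%:C).
Proof.
apply: smoothD; first exact: smoothD (smooth_expi c) (smooth_cst _).
under eq_fun do rewrite rmorphM mulrA -mulNr.
exact: smoothM (smooth_cst _) smooth_real.
Qed.

(** The value is bounded by 2 (c x)^2 and the first derivative by 2 c^2 |x|;
    from order two on the derivatives of exp(i c x) have modulus
    |c|^k <= c^2. *)
Lemma derivs_le_expiB1B N M (c : R) : 0 <= M -> `|c| <= 1 ->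
  derivs_le N M (fun x : R => expi (c * x) - 1 - 'i%C * (c * x)%:C)
    ((M ^+ 2 *+ 2 + M *+ 2 + 1) * c ^+ 2).
Proof.
move=> M0 c1; set B := _ * _.
have c20 : 0 <= c ^+ 2 by exact: sqr_ge0.
have M20 : 0 <= M ^+ 2 by exact: sqr_ge0.
have nc : normc ('i%C * c%:C) = `|c| by rewrite normcM normc_i normc_real mul1r.
have cM x : `|x| <= M -> `|c * x| <= `|c| * M by rewrite normrM => /ler_wpM2l ->.
have d1 x : has_cderive (fun x : R => expi (c * x) - 1 - 'i%C * (c * x)%:C) x
    ('i%C * c%:C * (expi (c * x) - 1)).
  have h2 : has_cderive (fun x : R => - ('i%C * c%:C) * x%:C) x
      (0 * x%:C + - ('i%C * c%:C) * 1).
    exact: has_cderiveM (has_cderive_cst _ _) (has_cderive_real _).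
  have h := has_cderiveD
    (has_cderiveD (has_cderive_expi c x) (has_cderive_cst (-1) x)) h2.
  have <- : 'i%C * c%:C * expi (c * x) + 0 + (0 * x%:C + - ('i%C * c%:C) * 1) =
            'i%C * c%:C * (expi (c * x) - 1) by ring.
  congr (has_cderive _ _ _): h; apply/funext => t.
  by rewrite rmorphM mulNr mulrA.
move=> [|[|n]] x _ xM.
- rewrite cderive0; apply: le_trans (normc_expiB1B _) _.
  have x2 : x ^+ 2 <= M ^+ 2.
    by rewrite -real_normK ?num_real // lerXn2r // nnegrE.
  have := ler_wpM2r c20 x2; have := mulr_ge0 M0 c20; rewrite /B; lra.
- rewrite (has_cderive_val (d1 x)) normcM nc.
  apply: (@le_trans _ _ (`|c| * (`|c| * M *+ 2))).
    by rewrite ler_wpM2l // (le_trans (normc_expiB1 _)) // ler_wMn2r // cM.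
  have -> : `|c| * (`|c| * M *+ 2) = c ^+ 2 * M *+ 2.
    by rewrite -[c ^+ 2]real_normK ?num_real //; ring.
  have := mulr_ge0 M20 c20; rewrite /B; lra.
rewrite (cderive_has_Sn _ d1) cderiveZ; last first.
  exact: smooth_atD (smooth_at_expi _ _) (smooth_at_cst _ _).
rewrite cderiveD; [|exact: smooth_at_expi|exact: smooth_at_cst].
rewrite cderive_cst addr0 cderive_expi normcM nc normcM normcX nc normc_expi mulr1.
rewrite -exprS /B -[leLHS]mul1r.
apply: ler_pM => //; first by rewrite ler_wpDl // addr_ge0 // mulrn_wge0.
rewrite -real_normK ?num_real // -(subnKC (isT : (1 < n.+2)%N)) exprD.
by rewrite ler_piMr // exprn_ile1.
Qed.

(** The derivative at xi is taken at 0 for the distribution W = exp(- i xi x) T;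
    the remainder of its difference quotient is W applied to
    exp(- i h x) - 1 + i h x, bounded by the preceding lemma. *)
Lemma fourier_has_cderive T : exists S : cdistr R,
  forall xi, has_cderive (fourier T) xi (fourier S xi).
Proof.
pose chi x : R[i] := - 'i%C * x%:C.
have schi : smooth chi by exact: smoothM (smooth_cst _) smooth_real.
have [S HS] := cdistr_mul T schi; exists S => xi.
have [W HW] := cdistr_mul T (smooth_expi (- xi)).
have [C [N [M [C0 M0 WC]]]] := cdistr_bound W.
apply: (@has_cderive_quadratic _ _ _ _ (C * (M ^+ 2 *+ 2 + M *+ 2 + 1))) => h h1.
have hN : `|- h| <= 1 by rewrite normrN.
have := WC _ _ (smooth_expiB1B (- h)) (derivs_le_expiB1B (N := N) M0 hN).
rewrite HW sqrrN mulrA; congr (normc _ <= _).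
have se (c : R) : smooth (fun x => expi (c * x)) by exact: smooth_expi.
have sc := smoothM schi (se (- xi)).
have -> : (fun x : R => expi (- xi * x) *
      (expi (- h * x) - 1 - 'i%C * (- h * x)%:C)) =
    (fun x => (- h%:C) * (chi x * expi (- xi * x)) +
       (-1 * expi (- xi * x) + expi (- (h + xi) * x))).
  apply/funext => x; rewrite opprD mulrDl expiD /chi rmorphM rmorphN; ring.
have s1 := smoothM (smooth_cst (-1)) (se (- xi)).
rewrite (@cdistr_linear R T _ _ _ sc (smoothD s1 (se (- (h + xi))))).
rewrite (@cdistr_linear R T _ _ _ (se (- xi)) (se (- (h + xi)))) !fourierE HS.
ring.
Qed.

Lemma fourier_smooth T : smooth (fourier T).
Proof.
apply/smoothP => x; apply/smooth_at_diff_near => n; elim: n T => [|n IH] T.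
  have [S HS] := fourier_has_cderive T; split=> //.
  by near=> y; exact: has_cderive_cderivable (HS y).
have [S HS] := fourier_has_cderive T.
by apply: diff_nearS (IH S); near=> y; exact: HS.
Unshelve. all: by end_near. Qed.

End Distributions.

(** * Transport of the refinement equation and of the sum rules *)

Section Refinement.
Variable R : realType.
Local Notation C := R[i].

Lemma fourier_col_smooth r (phi : 'I_r -> cdistr R) :
  mx_smooth_near0 (fourier_col phi).
Proof.
move=> i j; rewrite smooth_near0E; under eq_fun do rewrite mxE.
exact: (smoothP _).1 (fourier_smooth (phi i)) 0.
Qed.

Lemma is_fourier_trig_mx r (U : R -> 'M[C]_r) (phi : 'I_r -> cdistr R) :
  trig_mx U -> exists psi : 'I_r -> cdistr R,
  forall xi, fourier_col psi xi = U xi *m fourier_col phi xi.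
Proof.
move=> tU.
have /choice[psi Hpsi] : forall i, exists S : cdistr R,
    fourier S =1 fun t => (U t *m fourier_col phi t) i 0.
  move=> i; rewrite -/(is_fourier _).
  have -> : (fun t => (U t *m fourier_col phi t) i 0) =
            (fun t => \sum_(j < r) U t i j * fourier (phi j) t).
    by apply/funext => t; rewrite mxE; apply: eq_bigr => j _; rewrite mxE.
  elim: (index_enum _) => [|j s IH].
    by under eq_fun do rewrite big_nil; exact: is_fourier0 (phi i).
  under eq_fun do rewrite big_cons.
  exact: (is_fourierD (is_fourier_trig (phi j) (tU i j)) IH).
exists psi => xi; apply/matrixP => i j; rewrite !ord1 -Hpsi.
by rewrite mxE.
Qed.

(** By the refinement equation and the first sum rule, v u is invariant under
    dilation by d up to order m, hence constant up to that order. *)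
Lemma pairing_eq1 m d r (a : l0 R r r) (v : R -> 'rV[C]_r)
    (u : R -> 'cV[C]_r) : (2 <= d)%N ->
  mx_smooth_near0 v -> mx_smooth_near0 u ->
  (forall xi, u (d%:R * xi) = symbol a xi *m u xi) ->
  eqO m (fun xi => v (d%:R * xi) *m symbol a xi) v ->
  v 0 *m u 0 = 1%:M -> eqO m (fun xi => v xi *m u xi) (fun=> 1%:M).
Proof.
move=> d2 sv su ua va vu0; rewrite -vu0.
apply: (eqO_dilate_cst d2 (F := fun xi => v xi *m u xi)); first exact: mx_smoothM.
have sa : mx_smooth_near0 (symbol a) by exact/trig_mx_smooth/trig_mx_symbol.
have sva := mx_smoothM (mx_smooth_dilate d%:R sv) sa.
refine (eqO_transitive _ (eqO_mulmx sva sv su su va (eqO_reflexive u))).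
by apply: eqO_ext => xi; rewrite ua mulmxA.
Qed.

(** In the product defining the new rules, v0(d xi) U(d xi) is congruent to
    v(d xi), since v0 U = v modulo order m, and the periodicity of U makes this
    valid at the shifted points too. *)
Lemma sum_rules_conj m d r (a a0 : l0 R r r) (v v0 : R -> 'rV[C]_r)
    (U : R -> 'M[C]_r) : (0 < m)%N -> (2 <= d)%N ->
  mx_smooth_near0 v -> mx_smooth_near0 v0 -> strongly_invertible U ->
  (forall xi, symbol a0 xi = U (d%:R * xi) *m symbol a xi *m invmx (U xi)) ->
  eqO m (fun xi => v xi *m invmx (U xi)) v0 ->
  sum_rules d m a v -> sum_rules d m a0 v0.
Proof.
move=> m0 d2 sv sv0 [/trig_poly_mxP tU unitU /trig_poly_mxP tUI] a0E vU [v00 va vg].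
have sU := trig_mx_smooth tU; have sUI := trig_mx_smooth tUI.
have ta := trig_mx_symbol a; have sa := trig_mx_smooth ta.
have d0 : d%:R != 0 :> R by rewrite pnatr_eq0 -lt0n ltnW.
have sdv := mx_smooth_dilate d%:R sv.
have sdv0U := mx_smooth_dilate d%:R (mx_smoothM sv0 sU).
have v0U : eqO m (fun xi => v0 xi *m U xi) v.
  refine (eqO_transitive (eqO_mulmx sv0 (mx_smoothM sv sUI) sU sU
    (eqO_symmetric vU) (eqO_reflexive U)) _).
  by apply: eqO_ext => xi; rewrite -mulmxA mulVmx // mulmx1.
have dv0U := eqO_dilate d%:R (mx_smoothM sv0 sU) sv v0U.
split.
- apply: contraNneq v00 => v00.
  have : v 0 *m invmx (U 0) = v0 0.
    by apply/matrixP => i j; have := vU 0%N m0 i j; rewrite !cderive0.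
  rewrite v00 => /(congr1 (mulmx^~ (U 0))).
  by rewrite -mulmxA mulVmx // mulmx1 mul0mx => ->.
- have vaUI := eqO_mulmx (mx_smoothM sdv0U sa) sv sUI sUI
    (eqO_transitive (eqO_mulmx sdv0U sdv sa sa dv0U (eqO_reflexive _)) va)
    (eqO_reflexive _).
  refine (eqO_transitive (eqO_ext _) (eqO_transitive vaUI vU)) => xi.
  by rewrite a0E !mulmxA.
move=> g gd; set c := 2 * pi * g%:R / d%:R.
have sac := trig_mx_shift c ta; have sUIc := trig_mx_shift c tUI.
have s0 : mx_smooth_near0 (fun=> 0 : 'rV[C]_r).
  by move=> i j; exact: smooth_at_cst.
have vgUI := eqO_mulmx (mx_smoothM sdv0U sac) s0 sUIc sUIc
  (eqO_transitive (eqO_mulmx sdv0U sdv sac sac dv0U (eqO_reflexive _)) (vg g gd))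
  (eqO_reflexive _).
refine (eqO_transitive (eqO_ext _) (eqO_transitive vgUI (eqO_ext _))) => xi.
  rewrite a0E !mulmxA.
  have -> // : U (d%:R * (xi + c)) = U (d%:R * xi).
  have -> : d%:R * (xi + c) = d%:R * xi + 2 * pi * g%:R by rewrite /c; field.
  by apply/matrixP => i j; exact: (trig_period _ _ (tU i j)).
by rewrite mul0mx.
Qed.

End Refinement.

Theorem theorem1p3 (R : realType) (d r m : nat) (hd : (2 <= d)%N)
    (hm : (0 < m)%N) (a : l0 R r r) (phi : 'I_r -> cdistr R)
    (hphi : forall xi : R,
      fourier_col phi (d%:R * xi) = symbol a xi *m fourier_col phi xi)
    (hphi0 : fourier_col phi 0 != 0)
    (v : l0 R 1 r) (hsr : sum_rules d m a (symbol v))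
    (hvphi : symbol v 0 *m fourier_col phi 0 = 1%:M)
    (v0 : R -> 'rV[R[i]]_r) (uphi : R -> 'cV[R[i]]_r)
    (hv0 : mx_smooth_near0 v0) (huphi : mx_smooth_near0 uphi)
    (hv0uphi : eqO m (fun xi => v0 xi *m uphi xi) (fun=> 1%:M))
    (hr : (2 <= r)%N) (n : nat) (hn : (0 < n)%N) :
  let good (U : R -> 'M[R[i]]_r) :=
    [/\ strongly_invertible U,
        eqO m (fun xi => symbol v xi *m invmx (U xi)) v0
      & eqO n (fun xi => U xi *m fourier_col phi xi) uphi] in
  (exists U : R -> 'M[R[i]]_r, good U) /\
  (forall U : R -> 'M[R[i]]_r, good U ->
    exists (phi0 : 'I_r -> cdistr R) (a0 : l0 R r r),
      [/\ forall xi : R, fourier_col phi0 xi = U xi *m fourier_col phi xi,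
          forall xi : R,
            symbol a0 xi = U (d%:R * xi) *m symbol a xi *m invmx (U xi),
          (forall xi : R,
             fourier_col phi0 (d%:R * xi) = symbol a0 xi *m fourier_col phi0 xi)
          /\ eqO n (fourier_col phi0) uphi
        & sum_rules d m a0 v0 /\ v0 0 *m fourier_col phi0 0 = 1%:M]).
Proof.
move=> good.
have sv := trig_mx_smooth (trig_mx_symbol v).
have sphi := fourier_col_smooth phi.
have [v00 va _] := hsr.
have vphi := pairing_eq1 hd sv sphi hphi va hvphi.
split; first exact: exists_strongly_invertible.
move=> U [siU vU Uphi]; have [/trig_poly_mxP tU unitU /trig_poly_mxP tUI] := siU.
have [phi0 Hphi0] := is_fourier_trig_mx phi tU.
have [a0 Ha0] : trig_poly_mx
    (fun xi => U (d%:R * xi) *m symbol a xi *m invmx (U xi)).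
  apply/trig_poly_mxP; apply: trig_mxM => //; apply: trig_mxM.
    by move=> i j; exact: trig_dilate (tU i j).
  exact: trig_mx_symbol.
exists phi0, a0; split.
- exact: Hphi0.
- by move=> xi; rewrite -Ha0.
- split=> [xi|].
    by rewrite -Ha0 !Hphi0 hphi !mulmxA mulmxKV.
  by apply: eqO_transitive Uphi; exact: eqO_ext.
split; first exact: sum_rules_conj vU hsr.
have <- : symbol v 0 *m invmx (U 0) = v0 0.
  by apply/matrixP => i j; have := vU 0%N hm i j; rewrite !cderive0.
by rewrite Hphi0 mulmxA mulmxKV.
Qed.
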